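(* Let $\xi=(\tau_L,\delta_L,\tau_R,\delta_R)\in\Phi_{\rm BYG}$ and suppose $J_1(\xi)>1$ and $J_2(\xi)<1$. Then $f_\xi$ is chaotic in the sense of Devaney on $\Lambda$: $f_\xi$ restricted to $\Lambda$ is topologically transitive, its periodic points are dense in $\Lambda$, and it has sensitive dependence on initial conditions on $\Lambda$.
   Context: For $\xi=(\tau_L,\delta_L,\tau_R,\delta_R)\in\mathbb{R}^4$ define the continuous piecewise-linear map $f_\xi:\mathbb{R}^2\to\mathbb{R}^2$ by $f_\xi(x,y)=(\tau_L x+y+1,\,-\delta_L x)$ if $x\le 0$ and $f_\xi(x,y)=(\tau_R x+y+1,\,-\delta_R x)$ if $x\ge 0$. Let $A_L=\begin{bmatrix}\tau_L&1\\-\delta_L&0\end{bmatrix}$ and $A_R=\begin{bmatrix}\tau_R&1\\-\delta_R&0\end{bmatrix}$. Let $\Phi=\{\xi\in\mathbb{R}^4: \tau_L>\delta_L+1,\ \delta_L>0,\ \tau_R<-(\delta_R+1),\ \delta_R>0\}$. For $\xi\in\Phi$ the eigenvalues of $A_L$ are real with $0<\lambda_L^s<1<\lambda_L^u$, the eigenvalues of $A_R$ are real with $\lambda_R^u<-1<\lambda_R^s<0$, $f_\xi$ is a homeomorphism, and $X=\left(\frac{1}{\delta_R+1-\tau_R},\frac{-\delta_R}{\delta_R+1-\tau_R}\right)$ is a saddle fixed point of $f_\xi$. Let $\phi(\xi)=\delta_R-\left(\tau_R+\delta_L+\delta_R-(1+\tau_R)\lambda_L^u\right)\lambda_L^u$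 and $\Phi_{\rm BYG}=\{\xi\in\Phi:\phi(\xi)>0\}$. Let $J_1(\xi)=\frac{\lambda_L^u(\lambda_R^u)^2}{\lambda_L^u+|\lambda_R^u|}$ and $J_2(\xi)=\max\left\{\lambda_L^s,\frac{\sqrt2\,\lambda_L^s}{\lambda_L^s+1}\right\}+\max\left\{|\lambda_R^s|,\frac{\sqrt2\,|\lambda_R^s|}{|\lambda_R^s|+1}\right\}$. The unstable manifold of $X$ is $W^u(X)=\{P: f_\xi^{-n}(P)\to X\text{ as }n\to\infty\}$ and $\Lambda$ is its closure. *)

(* Defs.v *)
From Stdlib Require Import Reals.
Open Scope R_scope.

Definition pt := (R * R)%type.

Definition f_xi (tL dL tR dR : R) (P : pt) : pt :=
  let (x, y) := P in
  if Rle_dec x 0 then (tL * x + y + 1, - dL * x)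
  else (tR * x + y + 1, - dR * x).

Fixpoint iter (f : pt -> pt) (n : nat) (P : pt) : pt :=
  match n with O => P | S k => f (iter f k P) end.

Definition dist2 (P Q : pt) : R :=
  sqrt ((fst P - fst Q) ^ 2 + (snd P - snd Q) ^ 2).

Definition in_Phi (tL dL tR dR : R) : Prop :=
  tL > dL + 1 /\ dL > 0 /\ tR < - (dR + 1) /\ dR > 0.

(* Eigenvalues of A_L (0 < lamLs < 1 < lamLu) and A_R (lamRu < -1 < lamRs < 0) *)
Definition lamLu (tL dL : R) : R := (tL + sqrt (tL ^ 2 - 4 * dL)) / 2.
Definition lamLs (tL dL : R) : R := (tL - sqrt (tL ^ 2 - 4 * dL)) / 2.
Definition lamRu (tR dR : R) : R := (tR - sqrt (tR ^ 2 - 4 * dR)) / 2.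
Definition lamRs (tR dR : R) : R := (tR + sqrt (tR ^ 2 - 4 * dR)) / 2.

Definition phi_BYG (tL dL tR dR : R) : R :=
  dR - (tR + dL + dR - (1 + tR) * lamLu tL dL) * lamLu tL dL.

Definition J1 (tL dL tR dR : R) : R :=
  lamLu tL dL * (lamRu tR dR) ^ 2 / (lamLu tL dL + Rabs (lamRu tR dR)).

Definition J2 (tL dL tR dR : R) : R :=
  Rmax (lamLs tL dL) (sqrt 2 * lamLs tL dL / (lamLs tL dL + 1)) +
  Rmax (Rabs (lamRs tR dR)) (sqrt 2 * Rabs (lamRs tR dR) / (Rabs (lamRs tR dR) + 1)).

Definition fixX (tR dR : R) : pt :=
  (1 / (dR + 1 - tR), - dR / (dR + 1 - tR)).

(* Unstable manifold: P has a backward orbit (P = Q 0, f (Q (n+1)) = Q n)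
   converging to X.  Since f is a homeomorphism, Q n = f^{-n}(P). *)
Definition Wu (f : pt -> pt) (X : pt) (P : pt) : Prop :=
  exists Q : nat -> pt, Q O = P /\ (forall n, f (Q (S n)) = Q n) /\
    (forall eps, eps > 0 -> exists N, forall n, (n >= N)%nat -> dist2 (Q n) X < eps).

Definition closure2 (A : pt -> Prop) (P : pt) : Prop :=
  forall eps, eps > 0 -> exists Q, A Q /\ dist2 P Q < eps.

Definition open2 (U : pt -> Prop) : Prop :=
  forall P, U P -> exists eps, eps > 0 /\ forall Q, dist2 P Q < eps -> U Q.

(* Devaney chaos of f restricted to the set L.
   Relatively open subsets of L are the sets L ∩ U with U open in R^2. *)
Definition top_transitive_on (f : pt -> pt) (L : pt -> Prop) : Prop :=
  forall U V : pt -> Prop, open2 U -> open2 V ->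
    (exists P, L P /\ U P) -> (exists P, L P /\ V P) ->
    exists n : nat, (n >= 1)%nat /\ exists Q, L Q /\ U Q /\ V (iter f n Q).

Definition dense_periodic_on (f : pt -> pt) (L : pt -> Prop) : Prop :=
  forall P, L P -> forall eps, eps > 0 ->
    exists Q, L Q /\ dist2 P Q < eps /\ exists n : nat, (n >= 1)%nat /\ iter f n Q = Q.

Definition sensitive_on (f : pt -> pt) (L : pt -> Prop) : Prop :=
  exists delta, delta > 0 /\ forall P, L P -> forall eps, eps > 0 ->
    exists Q, L Q /\ dist2 P Q < eps /\ exists n : nat, dist2 (iter f n P) (iter f n Q) > delta.

Definition devaney_chaotic_on (f : pt -> pt) (L : pt -> Prop) : Prop :=
  top_transitive_on f L /\ dense_periodic_on f L /\ sensitive_on f L.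

(* Main.v *)
Require Import Defs.
From Stdlib Require Import Reals Lra Lia Arith.
Open Scope R_scope.

(** The triangle bounded by the stable and unstable lines of the left saddle Y
    and the image of the unstable one is forward invariant: this is [phi > 0].
    Since [lamLs + |lamRs| < 1] (from [J2 < 1]), the stable line of X separates
    the part of the triangle in [x >= 0], so a segment with slope in
    [[-lamLs, |lamRs|]] that straddles [x = 0] either meets the stable manifold
    of X or has its folded image entirely to the right of it.  With [J1 > 1] this
    makes every such segment grow until it meets the stable manifold of X.  Hence
    homoclinic points are dense in the unstable manifold, and f is affine near
    their orbits, which never meet [x = 0].  The inclination lemma then yields
    transitivity and sensitivity, and the periodic points near homoclinic points
    lie in the closure of the unstable manifold because their stable leaves
    cross it. *)

(** * Sup-norm neighbourhoods, iterates and segments *)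

(** The sup norm turns estimates for affine maps into linear inequalities in each coordinate. *)
Definition near (P Q : pt) (e : R) : Prop :=
  Rabs (fst P - fst Q) < e /\ Rabs (snd P - snd Q) < e.

Lemma dist2_near P Q e : dist2 P Q < e -> near P Q e.
Proof.
unfold dist2, near; intros H.
split; apply Rle_lt_trans with (2 := H); rewrite <- sqrt_Rsqr_abs;
  apply sqrt_le_1_alt; unfold Rsqr;
  pose proof (pow2_ge_0 (fst P - fst Q)); pose proof (pow2_ge_0 (snd P - snd Q));
  lra.
Qed.

Lemma near_dist2 P Q e : near P Q e -> dist2 P Q < 2 * e.
Proof.
unfold dist2, near; intros [Hx Hy].
assert (He : 0 < e) by (pose proof (Rabs_pos (fst P - fst Q)); lra).
apply Rabs_def2 in Hx; apply Rabs_def2 in Hy.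
rewrite <- (sqrt_Rsqr (2 * e)) by lra.
assert (Hsq : forall z, - e < z -> z < e -> 0 <= z ^ 2 < e * e) by (intros; nra).
destruct Hx as [Hx1 Hx2], Hy as [Hy1 Hy2].
pose proof (Hsq _ Hx2 Hx1); pose proof (Hsq _ Hy2 Hy1).
apply sqrt_lt_1_alt; unfold Rsqr; nra.
Qed.

Lemma near_sym P Q e : near P Q e -> near Q P e.
Proof.
unfold near; intros [Hx Hy]; split; rewrite Rabs_minus_sym; assumption.
Qed.

Lemma near_trans P Q S d e : near P Q d -> near Q S e -> near P S (d + e).
Proof.
unfold near; intros [H1 H2] [H3 H4].
apply Rabs_def2 in H1; apply Rabs_def2 in H2.
apply Rabs_def2 in H3; apply Rabs_def2 in H4.
split; apply Rabs_def1; lra.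
Qed.

Lemma iter_plus f m n P : iter f (m + n) P = iter f m (iter f n P).
Proof. induction m as [|m IH]; simpl; [reflexivity | now rewrite IH]. Qed.

Lemma iter_succ_r f n P : iter f (S n) P = iter f n (f P).
Proof.
replace (S n) with (n + 1)%nat by lia; rewrite iter_plus; reflexivity.
Qed.

Lemma invariant_iter f (A : pt -> Prop) n P :
  (forall Q, A Q -> A (f Q)) -> A P -> A (iter f n P).
Proof. intros H HP; induction n; simpl; auto. Qed.

Definition seg (A B : pt) (t : R) : pt :=
  (fst A + t * (fst B - fst A), snd A + t * (snd B - snd A)).

Lemma seg_seg A B r s t :
  seg (seg A B r) (seg A B s) t = seg A B (r + t * (s - r)).
Proof. unfold seg; simpl; f_equal; ring. Qed.

Lemma seg_0 A B : seg A B 0 = A.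
Proof. destruct A; unfold seg; simpl; f_equal; ring. Qed.

Lemma seg_1 A B : seg A B 1 = B.
Proof. destruct A, B; unfold seg; simpl; f_equal; ring. Qed.

(** * The map in terms of its eigenvalues, and its continuity *)

Section NormalForm.

(* [l] and [a] are the eigenvalues of A_L, [- U] and [- b] those of A_R. *)
Variables l a U b : R.
Hypothesis Hl : 1 < l.
Hypothesis Ha : 0 < a.
Hypothesis HU : 1 < U.
Hypothesis Hb : 0 < b.
Hypothesis Hab : a + b < 1.
Hypothesis Hphi :
  0 < U * b - (- (U + b) + l * a + U * b - (1 - (U + b)) * l) * l.
Hypothesis HJ : l + U < l * U ^ 2.

Definition nform : pt -> pt := f_xi (l + a) (l * a) (- (U + b)) (U * b).
Arguments nform : simpl never.
Notation f := nform.

Lemma f_left P : fst P <= 0 ->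
  f P = ((l + a) * fst P + snd P + 1, - (l * a) * fst P).
Proof.
destruct P as [x y]; unfold nform, f_xi; simpl; intros H.
destruct (Rle_dec x 0); [reflexivity | lra].
Qed.

Lemma f_right P : 0 <= fst P ->
  f P = (- (U + b) * fst P + snd P + 1, - (U * b) * fst P).
Proof.
destruct P as [x y]; unfold nform, f_xi; simpl; intros H.
destruct (Rle_dec x 0); [|reflexivity].
replace x with 0 by lra; f_equal; ring.
Qed.

(** Since [Rmin _ 0] and [Rmax _ 0] are 1-Lipschitz, this single formula gives a Lipschitz bound
    across the axis as well. *)
Lemma f_minmax P :
  f P = ((l + a) * Rmin (fst P) 0 - (U + b) * Rmax (fst P) 0 + snd P + 1,
         - (l * a) * Rmin (fst P) 0 - (U * b) * Rmax (fst P) 0).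
Proof.
destruct (Rle_dec (fst P) 0) as [H|H].
- rewrite f_left, Rmin_left, Rmax_right by lra; f_equal; ring.
- rewrite f_right, Rmin_right, Rmax_left by lra; f_equal; ring.
Qed.

Lemma f_continuous P e : 0 < e ->
  exists d, 0 < d /\ forall Q, near Q P d -> near (f Q) (f P) e.
Proof.
(* A Lipschitz constant in the sup norm: the sum of the absolute coefficients in [f_minmax]. *)
intros He; set (K := 1 + (l + a) + (U + b) + l * a + U * b).
assert (Hla : 0 < l * a) by nra. assert (HUb : 0 < U * b) by nra.
assert (HK : 0 < K) by (unfold K; lra).
exists (e / K); split; [apply Rdiv_lt_0_compat; lra|].
intros Q [Hx Hy]; rewrite !f_minmax; unfold near; simpl.
set (d := e / K) in *.
assert (HKd : e = K * d) by (unfold d; field; lra).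
apply Rabs_def2 in Hx; apply Rabs_def2 in Hy.
assert (Hm : - d < Rmin (fst Q) 0 - Rmin (fst P) 0 < d)
  by (unfold Rmin; destruct (Rle_dec (fst Q) 0), (Rle_dec (fst P) 0); lra).
assert (HM : - d < Rmax (fst Q) 0 - Rmax (fst P) 0 < d)
  by (unfold Rmax; destruct (Rle_dec (fst Q) 0), (Rle_dec (fst P) 0); lra).
set (m := Rmin (fst Q) 0) in *; set (m' := Rmin (fst P) 0) in *.
set (M := Rmax (fst Q) 0) in *; set (M' := Rmax (fst P) 0) in *.
assert (Hprod : forall c z, 0 < c -> - d < z < d -> - (c * d) < c * z < c * d)
  by (intros; nra).
pose proof (Hprod (l + a) _ ltac:(lra) Hm).
pose proof (Hprod (U + b) _ ltac:(lra) HM).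
pose proof (Hprod (l * a) _ ltac:(lra) Hm).
pose proof (Hprod (U * b) _ ltac:(lra) HM).
assert (0 < d) by lra.
assert (0 < (l + a) * d) by nra. assert (0 < (U + b) * d) by nra.
assert (0 < (l * a) * d) by nra. assert (0 < (U * b) * d) by nra.
unfold K in HKd; split; apply Rabs_def1; lra.
Qed.

Lemma iter_continuous n P e : 0 < e ->
  exists d, 0 < d /\ forall Q, near Q P d -> near (iter f n Q) (iter f n P) e.
Proof.
revert e; induction n as [|n IH]; simpl; intros e He.
- exists e; auto.
- destruct (f_continuous (iter f n P) e He) as [d1 [Hd1 H1]].
  destruct (IH d1 Hd1) as [d [Hd H]].
  exists d; auto.
Qed.

(** * The forward invariant triangle *)

(* The triangle of the header: nonnegative side of the stable line of Y, side
   [y + a x <= a / (1 - a)] of its unstable line, and the side above the image of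
   the latter, through [D = (1 / (1 - a), 0)]; denominators are cleared. *)
Definition trap (P : pt) : Prop :=
  0 <= (l - 1) * (snd P + l * fst P) + l /\
  (1 - a) * (snd P + a * fst P) <= a /\
  U * b * ((1 - a) * fst P - 1) <= (1 - a) * (U + b + a) * snd P.

Lemma trap_invariant P : trap P -> trap (f P).
Proof.
destruct P as [x y]; unfold trap; simpl; intros (H1 & H2 & H3).
assert (HUb : 0 < U * b) by nra. assert (Hla : 0 < l * a) by nra.
destruct (Rle_dec x 0) as [Hx|Hx].
(* The first two edges lie on eigenlines of the left branch, so their inequalities reproduce
   themselves with factors [l] and [a]. The third holds because the image has nonnegative ordinate
   and does not lie beyond the abscissa of [D]. *)
- rewrite f_left by (simpl; lra); simpl.
  split; [|split].
  + replace ((l - 1) * (- (l * a) * x + l * ((l + a) * x + y + 1)) + l)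
      with (l * ((l - 1) * (y + l * x) + l)) by ring.
    assert (0 <= l * ((l - 1) * (y + l * x) + l)) by (apply Rmult_le_pos; lra).
    lra.
  + replace ((1 - a) * (- (l * a) * x + a * ((l + a) * x + y + 1)))
      with (a * ((1 - a) * (y + a * x)) + a * (1 - a)) by ring.
    assert (a * ((1 - a) * (y + a * x)) <= a * a)
      by (apply Rmult_le_compat_l; lra).
    lra.
  + assert (Hy : 0 <= - (l * a) * x) by nra.
    assert (Hz : 0 <= (1 - a) * (U + b + a) * (- (l * a) * x))
      by (apply Rmult_le_pos; [nra|lra]).
    assert (a * ((1 - a) * ((l + a) * x + y + 1) - 1) <= 0) by nra.
    assert ((1 - a) * ((l + a) * x + y + 1) - 1 <= 0) by nra.
    nra.
- rewrite f_right by (simpl; lra); simpl.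
  assert (Hx0 : 0 < x) by lra.
  split; [|split].
  + (* The expression is increasing in [y]; on the lower edge it is affine in
       [x] and nonnegative at both ends, by [Hphi] at [D]. *)
    set (c := (1 - a) * (U + b + a)) in *.
    assert (Hc : 0 < c) by (unfold c; apply Rmult_lt_0_compat; lra).
    (* [D] is the rightmost vertex: eliminate [y] between the second and third edges. *)
    assert (HxD : (1 - a) * x <= 1).
    { assert ((U + b + a) * ((1 - a) * (y + a * x)) <= (U + b + a) * a) by nra.
      assert ((U * b + a * (U + b + a)) * ((1 - a) * x - 1) <= 0) by
       (unfold c in H3; nra).
      assert (0 < U * b + a * (U + b + a)) by nra.
      nra. }
    (* The difference is [(U + a) * (1 - a - b)]. *)
    assert (Hc' : b * (1 + U) < c) by (unfold c; nra).
    set (phi := - (l - 1) * (U * b + l * (U + b)) + (1 - a) * l ^ 2).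
    assert (Hp : 0 < phi) by (unfold phi; lra).
    assert (Hend0 : 0 <= l * ((1 - a) * (c * l - (l - 1) * (U * b)))).
    { apply Rmult_le_pos; [lra|]; apply Rmult_le_pos; [lra|]; nra. }
    assert (Hs : 0 <= (1 - a) * x) by nra.
    set (E := (l - 1) * (- (U * b) * x + l * (- (U + b) * x + y + 1)) + l).
    assert (HE : (1 - a) * c * E =
      (1 - a) * (l * (l - 1)) * (c * y - U * b * ((1 - a) * x - 1))
      + (1 - (1 - a) * x) * (l * ((1 - a) * (c * l - (l - 1) * (U * b))))
      + (1 - a) * x * (c * phi)) by (unfold E, phi; ring).
    assert (0 <= (1 - a) * (l * (l - 1)) * (c * y - U * b * ((1 - a) * x - 1))).
    { apply Rmult_le_pos; [apply Rmult_le_pos; nra | lra]. }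
    assert (0 <= (1 - (1 - a) * x) * (l * ((1 - a) * (c * l - (l - 1) * (U * b)))))
      by (apply Rmult_le_pos; lra).
    assert (0 <= (1 - a) * x * (c * phi))
      by (apply Rmult_le_pos; [lra|]; apply Rmult_le_pos; lra).
    assert (0 < (1 - a) * c) by (apply Rmult_lt_0_compat; lra).
    apply Rmult_le_reg_l with ((1 - a) * c); [assumption|]; lra.
  + assert (0 <= (1 - a) * ((U * b + a * U + a * b + a * a) * x))
      by (apply Rmult_le_pos; [lra|]; apply Rmult_le_pos; nra).
    assert (a * ((1 - a) * (y + a * x)) <= a * a)
      by (apply Rmult_le_compat_l; lra).
    lra.
  (* The third edge is the image of the second line under the right branch, so the second inequality
     at the original point, times [U * b], is what is wanted. *)
  + assert (0 <= U * b * (a - (1 - a) * (y + a * x)))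
      by (apply Rmult_le_pos; lra).
    lra.
Qed.

(** * The expanded cone of directions *)

(** The bounding rays are the unstable directions [(1, - a)] of the left branch and [(1, b)] of the
    right one. The right branch reverses the horizontal direction, hence the changed sign in
    [pcone_right] and the exchanged endpoints in [cone_right]. *)
Definition pcone (dx dy : R) : Prop := 0 < dx /\ - a * dx <= dy <= b * dx.

Lemma pcone_left dx dy : pcone dx dy ->
  pcone ((l + a) * dx + dy) (- (l * a) * dx) /\ l * dx <= (l + a) * dx + dy.
Proof.
intros (H1 & H2 & H3); unfold pcone.
assert (0 < l * dx) by nra. assert (0 < a * (l * dx)) by nra.
assert (l * dx <= (l + a) * dx + dy) by lra.
repeat split; nra.
Qed.

Lemma pcone_right dx dy : pcone dx dy ->
  pcone ((U + b) * dx - dy) (U * b * dx) /\ U * dx <= (U + b) * dx - dy.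
Proof.
intros (H1 & H2 & H3); unfold pcone.
assert (0 < U * dx) by nra. assert (0 < b * (U * dx)) by nra.
assert (U * dx <= (U + b) * dx - dy) by lra.
repeat split; nra.
Qed.

Definition cone (A B : pt) : Prop := pcone (fst B - fst A) (snd B - snd A).

Lemma seg_fst_between A B t : cone A B -> 0 < t < 1 ->
  fst A < fst (seg A B t) < fst B.
Proof. intros [H _] Ht; unfold seg; simpl; nra. Qed.

Lemma f_seg_left A B t : fst A <= 0 -> fst B <= 0 -> 0 <= t <= 1 ->
  f (seg A B t) = seg (f A) (f B) t.
Proof.
intros HA HB Ht; rewrite !f_left; try assumption.
- unfold seg; simpl; f_equal; ring.
- unfold seg; simpl; nra.
Qed.

Lemma f_seg_right A B t : 0 <= fst A -> 0 <= fst B -> 0 <= t <= 1 ->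
  f (seg A B t) = seg (f A) (f B) t.
Proof.
intros HA HB Ht; rewrite !f_right; try assumption.
- unfold seg; simpl; f_equal; ring.
- unfold seg; simpl; nra.
Qed.

Lemma cone_left A B : cone A B -> fst B <= 0 ->
  cone (f A) (f B) /\ l * (fst B - fst A) <= fst (f B) - fst (f A).
Proof.
intros HC HB; assert (HAB : 0 < fst B - fst A) by apply HC.
apply pcone_left in HC; unfold cone; rewrite !f_left by lra; simpl.
replace ((l + a) * fst B + snd B + 1 - ((l + a) * fst A + snd A + 1))
  with ((l + a) * (fst B - fst A) + (snd B - snd A)) by ring.
replace (- (l * a) * fst B - - (l * a) * fst A)
  with (- (l * a) * (fst B - fst A)) by ring.
exact HC.
Qed.

Lemma cone_right A B : cone A B -> 0 <= fst A ->
  cone (f B) (f A) /\ U * (fst B - fst A) <= fst (f A) - fst (f B).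
Proof.
intros HC HA; assert (HAB : 0 < fst B - fst A) by apply HC.
apply pcone_right in HC; unfold cone; rewrite !f_right by lra; simpl.
replace (- (U + b) * fst A + snd A + 1 - (- (U + b) * fst B + snd B + 1))
  with ((U + b) * (fst B - fst A) - (snd B - snd A)) by ring.
replace (- (U * b) * fst A - - (U * b) * fst B)
  with (U * b * (fst B - fst A)) by ring.
exact HC.
Qed.

Lemma trap_seg A B t : trap A -> trap B -> 0 <= t <= 1 -> trap (seg A B t).
Proof.
unfold trap, seg; simpl; intros (A1 & A2 & A3) (B1 & B2 & B3) Ht.
assert (Hc : forall p q, 0 <= p -> 0 <= q -> 0 <= (1 - t) * p + t * q)
  by (intros; nra).
pose proof (Hc _ _ A1 B1).
pose proof (Hc _ _ (Rge_le _ _ (Rge_minus _ _ (Rle_ge _ _ A2)))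
                   (Rge_le _ _ (Rge_minus _ _ (Rle_ge _ _ B2)))).
pose proof (Hc _ _ (Rge_le _ _ (Rge_minus _ _ (Rle_ge _ _ A3)))
                   (Rge_le _ _ (Rge_minus _ _ (Rle_ge _ _ B3)))).
repeat split; lra.
Qed.

Lemma trap_bounded : exists W, 0 < W /\ forall P, trap P -> - W <= fst P <= W.
Proof.
(* The abscissa of [D], the rightmost vertex, minus the abscissa of the saddle Y, the leftmost
   one. *)
exists (1 / (1 - a) + (a / (1 - a) + l / (l - 1)) / (l - a)).
assert (H1 : 0 < / (1 - a)) by (apply Rinv_0_lt_compat; lra).
assert (H2 : 0 < / (l - 1)) by (apply Rinv_0_lt_compat; lra).
assert (H3 : 0 < / (l - a)) by (apply Rinv_0_lt_compat; lra).
assert (HD : 0 < 1 / (1 - a)) by (unfold Rdiv; lra).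
assert (HE : 0 < (a / (1 - a) + l / (l - 1)) / (l - a)).
{ unfold Rdiv; apply Rmult_lt_0_compat; [|lra]; nra. }
set (V := (a / (1 - a) + l / (l - 1)) / (l - a)) in *.
split; [lra|]; intros [x y]; unfold trap; simpl; intros (T1 & T2 & T3).
assert (x <= 1 / (1 - a)).
{ assert (HUb : 0 < U * b) by nra.
  assert ((U * b + a * (U + b + a)) * ((1 - a) * x - 1) <= 0) by nra.
  assert (0 < U * b + a * (U + b + a)) by nra.
  assert ((1 - a) * x <= 1) by nra.
  apply Rmult_le_reg_l with (1 - a); [lra|]; field_simplify; lra. }
assert (- V <= x).
{ assert (T1' : 0 <= (1 - a) * ((l - 1) * (y + l * x) + l))
    by (apply Rmult_le_pos; lra).
  assert (T2' : (l - 1) * ((1 - a) * (y + a * x)) <= (l - 1) * a)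
    by (apply Rmult_le_compat_l; lra).
  assert (HV : (1 - a) * (l - 1) * ((l - a) * V) = a * (l - 1) + l * (1 - a))
    by (unfold V; field; lra).
  assert (K : 0 <= (1 - a) * (l - 1) * ((l - a) * (x + V))) by lra.
  assert (0 <= x + V); [|lra].
  apply Rmult_le_reg_l with (l - a); [lra|]; rewrite Rmult_0_r.
  apply Rmult_le_reg_l with ((1 - a) * (l - 1)); [apply Rmult_lt_0_compat; lra|].
  lra. }
lra.
Qed.

(** * The stable line of the saddle X *)

(* [(1 + U) (U (x - X_x) - (y - X_y))]: its zero set is the line through the
   saddle X in the stable direction. *)
Definition sg (P : pt) : R := (1 + U) * (U * fst P - snd P) - U.

Lemma sg_seg A B t : sg (seg A B t) = (1 - t) * sg A + t * sg B.
Proof. unfold sg, seg; simpl; ring. Qed.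

Lemma sg_right P : 0 <= fst P -> sg (f P) = - U * sg P.
Proof. intros H; rewrite f_right by assumption; unfold sg; simpl; ring. Qed.

(** With [c = (1 - a) * (U + b + a)], the lower edge meets [x = 0] at height [- U * b / c] and the
    stable line at [- U / (1 + U)]. The latter is lower because [b * (1 + U) < c], which is
    [a + b < 1] multiplied by [U + a]; further left the steeper stable line only falls further
    below. *)
Lemma sg_left_neg P : trap P -> fst P <= 0 -> sg P < 0.
Proof.
destruct P as [x y]; unfold trap, sg; simpl; intros (_ & _ & H) Hx.
set (c := (1 - a) * (U + b + a)) in *.
assert (Hc : b * (1 + U) < c) by (unfold c; nra).
assert (Hc0 : 0 < c) by nra.
assert (E : c * (U - (1 + U) * (U * x - y)) =
  (1 + U) * (c * y - U * b * ((1 - a) * x - 1))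
  + (1 + U) * U * (- x * (c - b * (1 - a))) + U * (c - b * (1 + U))) by ring.
assert (0 <= (1 + U) * (c * y - U * b * ((1 - a) * x - 1)))
  by (apply Rmult_le_pos; lra).
assert (0 <= (1 + U) * U * (- x * (c - b * (1 - a)))).
{ apply Rmult_le_pos; [nra|]; apply Rmult_le_pos; nra. }
assert (0 < U * (c - b * (1 + U))) by (apply Rmult_lt_0_compat; lra).
assert (0 < c * (U - (1 + U) * (U * x - y))) by lra.
nra.
Qed.

Lemma sg_nonneg_right P : trap P -> 0 <= sg P -> 0 < fst P.
Proof.
intros HT H; destruct (Rle_dec (fst P) 0) as [Hx|Hx]; [|lra].
pose proof (sg_left_neg P HT Hx); lra.
Qed.

Lemma sg_zero_crossing A B : sg A * sg B < 0 ->
  exists t, 0 < t < 1 /\ sg (seg A B t) = 0.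
Proof.
intros H.
assert (Hd : sg A - sg B <> 0) by nra.
exists (sg A / (sg A - sg B)); split.
- assert (Hs : 0 < (sg A - sg B) ^ 2) by nra.
  replace (sg A / (sg A - sg B)) with (sg A * (sg A - sg B) / (sg A - sg B) ^ 2)
    by (field; assumption).
  split; [apply Rdiv_lt_0_compat; nra|].
  apply Rmult_lt_reg_r with ((sg A - sg B) ^ 2); [assumption|].
  unfold Rdiv; rewrite Rmult_assoc, Rinv_l by lra; nra.
- rewrite sg_seg; field; assumption.
Qed.

(** * Growth of segments until they meet the stable manifold *)

(** Avoiding the axis before time [k] makes the iterate affine near the point. For a point of the
    triangle the orbit avoids the axis afterwards too, by [stable_orbit]. *)
Definition hits (A B : pt) : Prop :=
  exists t, 0 < t < 1 /\ exists k, sg (iter f k (seg A B t)) = 0 /\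
    forall j, (j < k)%nat -> fst (iter f j (seg A B t)) <> 0.

Lemma hits_crossing A B : sg A * sg B < 0 -> hits A B.
Proof.
intros H; destruct (sg_zero_crossing A B H) as [t [Ht E]].
exists t; split; [assumption|]; exists 0%nat; split; [assumption|].
intros j Hj; lia.
Qed.

Lemma hits_sub A B r s : 0 <= r <= 1 -> 0 <= s <= 1 -> r <> s ->
  hits (seg A B r) (seg A B s) -> hits A B.
Proof.
intros Hr Hs Hrs [t [Ht H]]; rewrite seg_seg in H.
exists (r + t * (s - r)); split; [|exact H].
destruct (Rdichotomy _ _ Hrs); nra.
Qed.

Lemma hits_sym A B : hits B A -> hits A B.
Proof.
intros H; apply (hits_sub A B 1 0); try lra.
rewrite seg_0, seg_1; exact H.
Qed.

Lemma hits_image A B :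
  (forall t, 0 < t < 1 ->
     f (seg A B t) = seg (f A) (f B) t /\ fst (seg A B t) <> 0) ->
  hits (f A) (f B) -> hits A B.
Proof.
intros H [t [Ht [k [Hk Hj]]]]; destruct (H t Ht) as [E Hn].
exists t; split; [assumption|]; exists (S k); rewrite <- E in Hk, Hj; split.
- rewrite iter_succ_r; exact Hk.
- intros [|j] Hlt; [exact Hn|].
  rewrite iter_succ_r; apply Hj; lia.
Qed.

Lemma hits_left A B : cone A B -> fst B <= 0 -> hits (f A) (f B) -> hits A B.
Proof.
intros HC HB; apply hits_image; intros t Ht.
pose proof (seg_fst_between A B t HC Ht).
split; [apply f_seg_left|]; lra.
Qed.

Lemma hits_right A B : cone A B -> 0 <= fst A -> hits (f B) (f A) -> hits A B.
Proof.
intros HC HB H; apply hits_sym in H; revert H; apply hits_image; intros t Ht.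
pose proof (seg_fst_between A B t HC Ht).
split; [apply f_seg_right|]; lra.
Qed.

(** [q] is the quantity J1, so the least of [l], [U] and J1 is a growth rate above 1 that serves all
    cases of [hits_of_growth]. *)
Lemma rate_exists : exists mu,
  1 < mu /\ mu <= l /\ mu <= U /\ mu * (l + U) <= l * U ^ 2.
Proof.
exists (Rmin (Rmin l U) (l * U ^ 2 / (l + U))).
set (q := l * U ^ 2 / (l + U)).
assert (Hq : q * (l + U) = l * U ^ 2) by (unfold q; field; lra).
assert (Hq1 : 1 < q) by nra.
pose proof (Rmin_l (Rmin l U) q); pose proof (Rmin_r (Rmin l U) q).
pose proof (Rmin_l l U); pose proof (Rmin_r l U).
repeat split; try lra.
- repeat apply Rmin_glb_lt; lra.
- rewrite <- Hq; apply Rmult_le_compat_r; lra.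
Qed.

Section Growth.

Variables W mu : R.
Hypothesis Htrap : forall P, trap P -> - W <= fst P <= W.
Hypothesis Hmu : 1 < mu.
Hypothesis Hmul : mu <= l.
Hypothesis HmuU : mu <= U.
Hypothesis HmuJ : mu * (l + U) <= l * U ^ 2.

(* A segment that straddles the axis either meets the stable manifold within
   one step, or both halves of its image lie to the right of the stable line, so
   that two steps stretch one half beyond the length of the whole by [HmuJ]. *)
Lemma hits_of_growth n A B : cone A B -> trap A -> trap B ->
  2 * W < (fst B - fst A) * mu ^ n -> hits A B.
Proof.
revert A B; induction n as [|n IH]; intros A B HC HA HB Hw.
(* No segment of the triangle is wider than [2 * W], so the induction cannot run out of steps. *)
- pose proof (Htrap A HA); pose proof (Htrap B HB); simpl in Hw; lra.
- assert (Hpow : 0 < mu ^ n) by (apply pow_lt; lra).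
  assert (IH' : forall C D, cone C D -> trap C -> trap D ->
            mu * (fst B - fst A) <= fst D - fst C -> hits C D).
  { intros C D H1 H2 H3 H4; apply IH; try assumption.
    apply Rlt_le_trans with (1 := Hw); simpl.
    rewrite <- Rmult_assoc; apply Rmult_le_compat_r; lra. }
  clear IH Hw; pose proof (trap_invariant _ HA) as HfA.
  pose proof (trap_invariant _ HB) as HfB.
  assert (Hdx : 0 < fst B - fst A) by apply HC.
  destruct (Rle_dec (fst B) 0) as [HBx|HBx].
  { apply hits_left; try assumption.
    destruct (cone_left A B HC HBx); apply IH'; try assumption; nra. }
  destruct (Rle_dec 0 (fst A)) as [HAx|HAx].
  { apply hits_right; try assumption.
    destruct (cone_right A B HC HAx); apply IH'; try assumption; nra. }
  set (t := - fst A / (fst B - fst A)).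
  assert (Et : t * (fst B - fst A) = - fst A) by (unfold t; field; lra).
  assert (Ht : 0 < t < 1) by (split; nra).
  set (Z := seg A B t).
  assert (HZx : fst Z = 0) by (unfold Z, seg; simpl; lra).
  assert (HZ : trap Z) by (apply trap_seg; try assumption; lra).
  assert (HAZ : cone A Z).
  { destruct HC as (C1 & C2 & C3); unfold cone, pcone; rewrite HZx; unfold Z, seg; simpl.
    split; [lra|]; split; nra. }
  assert (HZB : cone Z B).
  { destruct HC as (C1 & C2 & C3); unfold cone, pcone; rewrite HZx; unfold Z, seg; simpl.
    split; [lra|]; split; nra. }
  assert (HsZ : sg Z < 0) by (apply sg_left_neg; lra || assumption).
  (* The fold point [f Z] lies beyond the stable line, as [sg] is multiplied by [- U]; an endpoint
     of the image on the other side gives a crossing. *)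
  assert (HsfZ : 0 < sg (f Z)) by (rewrite sg_right by lra; nra).
  pose proof (trap_invariant _ HZ) as HfZ.
  assert (HhL : hits A Z -> hits A B).
  { intros H; apply (hits_sub A B 0 t); try lra; rewrite seg_0; exact H. }
  assert (HhR : hits Z B -> hits A B).
  { intros H; apply (hits_sub A B t 1); try lra; rewrite seg_1; exact H. }
  destruct (Rlt_dec (sg (f A)) 0) as [HsA|HsA].
  { apply HhL, hits_left; try assumption; try lra.
    apply hits_crossing; nra. }
  destruct (Rlt_dec 0 (sg B)) as [HsB|HsB].
  { apply HhR, hits_crossing; nra. }
  assert (HfAx : 0 < fst (f A)) by (apply sg_nonneg_right; lra || assumption).
  assert (HfZx : 0 < fst (f Z)) by (apply sg_nonneg_right; lra || assumption).
  assert (HfBx : 0 < fst (f B)).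
  { apply sg_nonneg_right; [assumption|]; rewrite sg_right by lra; nra. }
  destruct (cone_left A Z HAZ ltac:(lra)) as [CL1 WL1].
  destruct (cone_right _ _ CL1 ltac:(lra)) as [CL2 WL2].
  destruct (cone_right Z B HZB ltac:(lra)) as [CR1 WR1].
  destruct (cone_right _ _ CR1 ltac:(lra)) as [CR2 WR2].
  rewrite HZx in WL1, WR1.
  set (wL := - fst A) in *; set (wR := fst B) in *.
  assert (HL : U * (l * wL) <= fst (f (f A)) - fst (f (f Z))).
  { apply Rle_trans with (2 := WL2); apply Rmult_le_compat_l; unfold wL in *; lra. }
  assert (HR : U * (U * wR) <= fst (f (f B)) - fst (f (f Z))).
  { apply Rle_trans with (2 := WR2); apply Rmult_le_compat_l; unfold wR in *; lra. }
  destruct (Rle_dec (mu * (wL + wR)) (U * (l * wL))) as [Hc|Hc].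
  { apply HhL, hits_left; try assumption; try lra.
    apply hits_right; try assumption; try lra.
    apply IH'; auto using trap_invariant; unfold wL, wR in *; lra. }
  destruct (Rle_dec (mu * (wL + wR)) (U * (U * wR))) as [Hc'|Hc'].
  { apply HhR, hits_right; try assumption; try lra.
    apply hits_right; try assumption; try lra.
    apply IH'; auto using trap_invariant; unfold wL, wR in *; lra. }
  (* With [w = wL + wR], the two failures weighted by [U] and [l] add up to
     [l * U ^ 2 * w < mu * (l + U) * w], against [HmuJ]. *)
  exfalso.
  assert (0 < wL + wR) by (unfold wL, wR in *; lra).
  assert (U * (U * (l * wL)) < U * (mu * (wL + wR)))
    by (apply Rmult_lt_compat_l; lra).
  assert (l * (U * (U * wR)) < l * (mu * (wL + wR)))
    by (apply Rmult_lt_compat_l; lra).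
  assert (mu * (l + U) * (wL + wR) <= l * U ^ 2 * (wL + wR))
    by (apply Rmult_le_compat_r; lra).
  lra.
Qed.

End Growth.

Lemma hits_of_cone A B : cone A B -> trap A -> trap B -> hits A B.
Proof.
intros HC HA HB.
destruct trap_bounded as [W [HW HT]].
destruct rate_exists as (mu & H1 & H2 & H3 & H4).
assert (Hd : 0 < fst B - fst A) by apply HC.
destruct (Pow_x_infinity mu ltac:(rewrite Rabs_right; lra)
            (2 * W / (fst B - fst A) + 1)) as [N HN].
apply (hits_of_growth W mu HT H1 H2 H3 H4 N); try assumption.
specialize (HN N (le_n N)).
rewrite Rabs_right in HN by (apply Rle_ge, pow_le; lra).
assert (E : 2 * W = 2 * W / (fst B - fst A) * (fst B - fst A)) by (field; lra).
nra.
Qed.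

(** * Eigencoordinates at the saddle X *)

(** The abscissa of X, since [dR + 1 - tR] factors as [(1 + U) * (1 + b)]. *)
Definition X0 : R := / ((1 + U) * (1 + b)).

Lemma X0_pos : 0 < X0.
Proof. apply Rinv_0_lt_compat; nra. Qed.

Lemma X0_eq : (1 + U) * (1 + b) * X0 = 1.
Proof. unfold X0; field; lra. Qed.

(* Eigencoordinates of the right branch at the saddle: [(1, b)] spans its
   unstable and [(1, U)] its stable direction. *)
Definition uv (u v : R) : pt :=
  (X0 + u + v, - (U * b) * X0 + b * u + U * v).

Lemma uv_surj P : exists u v, P = uv u v.
Proof.
exists ((U * (fst P - X0) - (snd P + U * b * X0)) / (U - b)),
  ((snd P + U * b * X0 - b * (fst P - X0)) / (U - b)).
destruct P as [x y]; unfold uv; simpl; f_equal; field; lra.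
Qed.

Lemma f_uv u v : 0 <= X0 + u + v -> f (uv u v) = uv (- U * u) (- b * v).
Proof.
intros H; rewrite f_right by exact H; unfold uv; simpl.
pose proof X0_eq; f_equal; lra.
Qed.

Lemma sg_uv u v : sg (uv u v) = (1 + U) * (U - b) * u.
Proof.
unfold sg, uv; simpl.
replace ((1 + U) * (U * (X0 + u + v) - (- (U * b) * X0 + b * u + U * v)) - U)
  with ((1 + U) * (U - b) * u + U * ((1 + U) * (1 + b) * X0 - 1)) by ring.
rewrite X0_eq; ring.
Qed.

Lemma near_uv u v u' v' e :
  Rabs (u - u') < e / (2 + U) -> Rabs (v - v') < e / (2 + U) ->
  near (uv u v) (uv u' v') e.
Proof.
intros Hu Hv; set (d := e / (2 + U)) in *.
assert (He : e = (2 + U) * d) by (unfold d; field; lra).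
apply Rabs_def2 in Hu; apply Rabs_def2 in Hv; rewrite He.
assert (Hd : 0 < d) by lra.
assert (Hprod : forall c z, 0 < c -> - d < z < d -> - (c * d) < c * z < c * d)
  by (intros; nra).
pose proof (Hprod b (u - u') ltac:(lra) ltac:(lra)).
pose proof (Hprod U (v - v') ltac:(lra) ltac:(lra)).
assert (0 < b * d < 1 * d) by (split; nra).
assert (0 < U * d) by nra.
unfold near, uv; simpl; split; apply Rabs_def1; lra.
Qed.

Lemma uv_near u v e : near (uv u v) (uv 0 0) e ->
  Rabs u < (1 + U) / (U - b) * e /\ Rabs v < (1 + U) / (U - b) * e.
Proof.
unfold near, uv; simpl; intros [H1 H2].
apply Rabs_def2 in H1; apply Rabs_def2 in H2.
assert (E : forall z, z = / (U - b) * ((U - b) * z)) by (intros; field; lra).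
assert (0 < / (U - b)) by (apply Rinv_0_lt_compat; lra).
replace ((1 + U) / (U - b) * e) with (/ (U - b) * ((1 + U) * e))
  by (field; lra).
assert (Hinv : forall z, - ((1 + U) * e) < (U - b) * z < (1 + U) * e ->
  Rabs z < / (U - b) * ((1 + U) * e)).
{ intros z Hz; apply Rabs_def1; rewrite (E z); [|rewrite Ropp_mult_distr_r];
    apply Rmult_lt_compat_l; lra. }
split; apply Hinv; split; nra.
Qed.

Lemma affine_nonneg_near c0 c1 : 0 < c0 ->
  exists r, 0 < r /\ forall u, Rabs u < r -> 0 <= c0 + c1 * u.
Proof.
intros H; exists (c0 / (Rabs c1 + 1)).
pose proof (Rabs_pos c1) as Hc.
split; [apply Rdiv_lt_0_compat; lra|]; intros u Hu.
assert (E : c0 = c0 / (Rabs c1 + 1) * (Rabs c1 + 1)) by (field; lra).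
assert (Rabs (c1 * u) <= c0).
{ rewrite Rabs_mult, E, Rmult_comm.
  apply Rmult_le_compat; try apply Rabs_pos; lra. }
pose proof (Rle_abs (- (c1 * u))); rewrite Rabs_Ropp in *; lra.
Qed.

(** The saddle satisfies the three edge inequalities strictly, and each is affine in [u]. The bound
    [X0 / 4] leaves room for the deviations in [return_chart]. *)
Lemma trap_near_saddle : exists r, 0 < r /\ r <= X0 / 4 /\
  forall u, Rabs u < r -> trap (uv u 0).
Proof.
pose proof X0_pos as HX; pose proof X0_eq as EX.
assert (HUb : 0 < U * b) by nra.
assert (0 < U * X0) by nra. assert (0 < b * X0) by nra.
assert (0 < U * b * X0) by nra.
destruct (affine_nonneg_near ((l - 1) * (- (U * b) * X0 + l * X0) + l)
            ((l - 1) * (b + l))) as [r1 [Hr1 T1]].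
{ assert ((l - 1) * (U * b * X0) < (l - 1) * 1)
    by (apply Rmult_lt_compat_l; lra).
  assert (0 < (l - 1) * (l * X0)) by (apply Rmult_lt_0_compat; nra).
  lra. }
destruct (affine_nonneg_near (a - (1 - a) * (- (U * b) * X0 + a * X0))
            (- (1 - a) * (b + a))) as [r2 [Hr2 T2]].
{ assert (0 < (1 - a) * (U * b * X0)) by (apply Rmult_lt_0_compat; lra).
  assert (a * X0 < a * 1) by (apply Rmult_lt_compat_l; lra).
  assert (0 < a * (a * X0)) by (apply Rmult_lt_0_compat; nra).
  lra. }
destruct (affine_nonneg_near
   ((1 - a) * (U + b + a) * (- (U * b) * X0) - U * b * ((1 - a) * X0 - 1))
   ((1 - a) * (U + b + a) * b - U * b * (1 - a))) as [r3 [Hr3 T3]].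
{ assert ((1 - a) * (1 + U + b + a) * X0 < 1).
  { apply Rlt_le_trans with ((1 + U) * (1 + b) * X0); [|lra].
    apply Rmult_lt_compat_r; [lra|]; nra. }
  replace (_ - _) with (U * b * (1 - (1 - a) * (1 + U + b + a) * X0)) by ring.
  apply Rmult_lt_0_compat; lra. }
exists (Rmin (Rmin r1 r2) (Rmin r3 (X0 / 4))).
pose proof (Rmin_l (Rmin r1 r2) (Rmin r3 (X0 / 4))).
pose proof (Rmin_r (Rmin r1 r2) (Rmin r3 (X0 / 4))).
pose proof (Rmin_l r1 r2). pose proof (Rmin_r r1 r2).
pose proof (Rmin_l r3 (X0 / 4)). pose proof (Rmin_r r3 (X0 / 4)).
split; [repeat apply Rmin_glb_lt; lra|]; split; [lra|].
intros u Hu; specialize (T1 u ltac:(lra)); specialize (T2 u ltac:(lra)).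
specialize (T3 u ltac:(lra)).
unfold trap, uv; simpl; repeat split; lra.
Qed.

(** In the triangle, [sg = 0] forces a positive abscissa, so the orbit never leaves the right
    branch, where the stable coordinate is multiplied by [- b]. *)
Lemma stable_orbit v n : trap (uv 0 v) ->
  iter f n (uv 0 v) = uv 0 ((- b) ^ n * v) /\
  0 < fst (iter f n (uv 0 v)) /\ trap (iter f n (uv 0 v)).
Proof.
intros HT; induction n as [|n (E & Hx & Ht)].
- simpl iter; rewrite pow_O, Rmult_1_l; repeat split; try apply HT.
  apply sg_nonneg_right; [assumption|]; rewrite sg_uv; lra.
- simpl iter; pose proof (trap_invariant _ Ht) as Ht'.
  rewrite E in Hx, Ht' |- *; simpl in Hx.
  assert (E' : f (uv 0 ((- b) ^ n * v)) = uv 0 ((- b) ^ S n * v)).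
  { rewrite f_uv by lra; f_equal; simpl; ring. }
  rewrite E' in Ht' |- *; split; [reflexivity|]; split; [|assumption].
  apply sg_nonneg_right; [assumption|]; rewrite sg_uv; lra.
Qed.

(** * Homoclinic points and the affine form of iterates near them *)

Lemma cone_unstable u1 u2 : u1 < u2 -> cone (uv u1 0) (uv u2 0).
Proof. intros H; unfold cone, pcone, uv; simpl; nra. Qed.

(** A short piece of the local unstable manifold has direction [(1, b)], on the boundary of the
    cone, so [hits_of_cone] applies to it. *)
Lemma homoclinic_dense r u0 e :
  (forall u, Rabs u < r -> trap (uv u 0)) -> Rabs u0 < r -> 0 < e ->
  exists u k v, Rabs (u - u0) < e /\ Rabs u < r /\
    (forall j, fst (iter f j (uv u 0)) <> 0) /\
    forall j, iter f (j + k) (uv u 0) = uv 0 ((- b) ^ j * v).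
Proof.
intros Hr Hu0 He; set (u1 := u0 + Rmin e (r - Rabs u0) / 2).
pose proof (Rmin_l e (r - Rabs u0)) as M1.
pose proof (Rmin_r e (r - Rabs u0)) as M2.
assert (Hm : 0 < Rmin e (r - Rabs u0)) by (apply Rmin_glb_lt; lra).
set (m := Rmin e (r - Rabs u0)) in *.
assert (Hb0 : - r + m <= u0 <= r - m).
{ pose proof (Rle_abs u0); pose proof (Rle_abs (- u0)).
  rewrite Rabs_Ropp in *; lra. }
assert (Hu1 : Rabs u1 < r) by (apply Rabs_def1; unfold u1; lra).
destruct (hits_of_cone (uv u0 0) (uv u1 0)) as [t [Ht [k [Hk Hj]]]]; auto.
{ apply cone_unstable; unfold u1; lra. }
set (u := u0 + t * (m / 2)).
assert (Eu : seg (uv u0 0) (uv u1 0) t = uv u 0)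
  by (unfold seg, uv, u, u1; simpl; f_equal; field).
rewrite Eu in Hk, Hj.
assert (0 < t * (m / 2) < m / 2) by (split; nra).
assert (Hu : Rabs u < r) by (apply Rabs_def1; unfold u; lra).
pose proof (invariant_iter _ trap k _ trap_invariant (Hr u Hu)) as Htk.
destruct (uv_surj (iter f k (uv u 0))) as [u' [v Ek]].
rewrite Ek in Hk, Htk; rewrite sg_uv in Hk.
assert (Hu' : u' = 0).
{ apply Rmult_eq_reg_l with ((1 + U) * (U - b)); [lra|].
  apply Rgt_not_eq, Rmult_lt_0_compat; lra. }
rewrite Hu' in Ek, Htk; exists u, k, v.
repeat split; [apply Rabs_def1; unfold u; lra | assumption | |].
- intros j; destruct (Nat.le_gt_cases k j) as [Hkj|Hkj]; [|now apply Hj].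
  replace j with ((j - k) + k)%nat by lia; rewrite iter_plus, Ek.
  apply Rgt_not_eq, (stable_orbit v _ Htk).
- intros j; rewrite iter_plus, Ek; apply (stable_orbit v _ Htk).
Qed.

Lemma f_affine_near W : fst W <> 0 ->
  exists d t D, 0 < d /\
    (forall Q, near Q W d ->
      f Q = (fst (f W) + (t * (fst Q - fst W) + (snd Q - snd W)),
             snd (f W) - D * (fst Q - fst W))) /\
    (t = l + a /\ D = l * a \/ t = - (U + b) /\ D = U * b).
Proof.
intros HW; destruct (Rdichotomy _ _ HW) as [H|H].
- exists (- fst W), (l + a), (l * a); split; [lra|]; split; [|left; lra].
  intros Q [HQ _]; apply Rabs_def2 in HQ.
  rewrite !f_left by lra; simpl; f_equal; ring.
- exists (fst W), (- (U + b)), (U * b); split; [lra|]; split; [|right; lra].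
  intros Q [HQ _]; apply Rabs_def2 in HQ.
  rewrite !f_right by lra; simpl; f_equal; ring.
Qed.

(** Both halves are needed because the right branch exchanges them. *)
Definition dcone (dx dy : R) : Prop := pcone dx dy \/ pcone (- dx) (- dy).

Lemma iter_affine_near n Z : (forall j, (j < n)%nat -> fst (iter f j Z) <> 0) ->
  exists d p q r s, 0 < d /\
    (forall Q, near Q Z d -> iter f n Q =
       (fst (iter f n Z) + (p * (fst Q - fst Z) + q * (snd Q - snd Z)),
        snd (iter f n Z) + (r * (fst Q - fst Z) + s * (snd Q - snd Z)))) /\
    forall dx dy, dcone dx dy -> dcone (p * dx + q * dy) (r * dx + s * dy).
Proof.
induction n as [|n IH]; intros HZ.
- exists 1, 1, 0, 0, 1; split; [lra|]; split.
  + intros [x y] _; simpl; f_equal; ring.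
  + intros dx dy H; replace (1 * dx + 0 * dy) with dx by ring.
    replace (0 * dx + 1 * dy) with dy by ring; exact H.
- destruct IH as (d1 & p & q & r & s & Hd1 & HF & HC).
  { intros j Hj; apply HZ; lia. }
  destruct (f_affine_near (iter f n Z) (HZ n ltac:(lia)))
    as (d2 & t & D & Hd2 & HA & Ht).
  destruct (iter_continuous n Z d2 Hd2) as [d3 [Hd3 HK]].
  exists (Rmin d1 d3), (t * p + r), (t * q + s), (- D * p), (- D * q).
  pose proof (Rmin_l d1 d3); pose proof (Rmin_r d1 d3).
  split; [apply Rmin_glb_lt; lra|]; split.
  + intros Q [HQ1 HQ2]; simpl iter.
    rewrite (HA (iter f n Q)) by (apply HK; split; lra).
    rewrite (HF Q) by (split; lra); simpl; f_equal; ring.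
  + intros dx dy H'; specialize (HC dx dy H').
    set (X := p * dx + q * dy) in *; set (Y := r * dx + s * dy) in *.
    replace ((t * p + r) * dx + (t * q + s) * dy) with (t * X + Y)
      by (unfold X, Y; ring).
    replace (- D * p * dx + - D * q * dy) with (- D * X) by (unfold X; ring).
    unfold dcone in *; destruct Ht as [[-> ->]|[-> ->]], HC as [HC|HC].
    * left; apply (pcone_left _ _ HC).
    * right; replace (- ((l + a) * X + Y)) with ((l + a) * (- X) + - Y) by ring.
      replace (- (- (l * a) * X)) with (- (l * a) * - X) by ring.
      apply (pcone_left _ _ HC).
    * right; replace (- (- (U + b) * X + Y)) with ((U + b) * X - Y) by ring.
      replace (- (- (U * b) * X)) with (U * b * X) by ring.
      apply (pcone_right _ _ HC).
    * left; replace (- (U + b) * X + Y) with ((U + b) * (- X) - - Y) by ring.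
      replace (- (U * b) * X) with (U * b * - X) by ring.
      apply (pcone_right _ _ HC).
Qed.

(** [al <> 0] is transversality: the image of the unstable direction [(1, b)] stays in the double
    cone, whose slopes are at most [b < U], so it is not the stable direction [(1, U)]. *)
Lemma iter_affine_uv n u v u1 v1 :
  (forall j, (j < n)%nat -> fst (iter f j (uv u v)) <> 0) ->
  iter f n (uv u v) = uv u1 v1 ->
  exists d al be ga de, 0 < d /\ al <> 0 /\
    forall xi eta, Rabs xi < d -> Rabs eta < d ->
      iter f n (uv (u + xi) (v + eta)) =
      uv (u1 + (al * xi + be * eta)) (v1 + (ga * xi + de * eta)).
Proof.
intros HZ EZ; destruct (iter_affine_near n _ HZ) as (d & p & q & r & s & Hd & HF & HC).
exists (d / (2 + U)),
  ((U * (p + q * b) - (r + s * b)) / (U - b)),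
  ((U * (p + q * U) - (r + s * U)) / (U - b)),
  ((r + s * b - b * (p + q * b)) / (U - b)),
  ((r + s * U - b * (p + q * U)) / (U - b)).
split; [apply Rdiv_lt_0_compat; lra|]; split.
- assert (H1 : dcone 1 b) by (left; unfold pcone; lra).
  apply HC in H1; rewrite !Rmult_1_r in H1.
  assert (U * (p + q * b) - (r + s * b) <> 0).
  { destruct H1 as [(H1 & H2 & H3)|(H1 & H2 & H3)]; nra. }
  apply Rmult_integral_contrapositive_currified; [assumption|].
  apply Rinv_neq_0_compat; lra.
- intros xi eta Hxi Heta; rewrite HF.
  + rewrite EZ; unfold uv; simpl; f_equal; field; lra.
  + apply near_uv; [replace (u + xi - u) with xi by ring
                   |replace (v + eta - v) with eta by ring]; assumption.
Qed.

(** The unstable coordinate grows and the stable one shrinks, so bounding the former at the last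
    time and the latter at the first keeps the abscissa [X0 + u + v] nonnegative throughout. *)
Lemma linear_phase n u v : Rabs (U ^ n * u) <= X0 / 2 -> Rabs v <= X0 / 2 ->
  iter f n (uv u v) = uv ((- U) ^ n * u) ((- b) ^ n * v).
Proof.
intros Hu Hv; induction n as [|n IH].
- simpl; f_equal; ring.
- assert (Hpow : forall w m, Rabs ((- w) ^ m) = Rabs w ^ m)
    by (intros; rewrite <- RPow_abs, Rabs_Ropp; reflexivity).
  assert (Hu' : Rabs (U ^ n * u) <= X0 / 2).
  { apply Rle_trans with (2 := Hu); rewrite !Rabs_mult.
    apply Rmult_le_compat_r; [apply Rabs_pos|].
    rewrite !Rabs_right by (apply Rle_ge, pow_le; lra).
    apply Rle_pow; [lra | lia]. }
  assert (Hu2 : Rabs ((- U) ^ n * u) <= X0 / 2).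
  { rewrite Rabs_mult, Hpow, RPow_abs, <- Rabs_mult; assumption. }
  assert (Hv2 : Rabs ((- b) ^ n * v) <= X0 / 2).
  { apply Rle_trans with (2 := Hv); rewrite Rabs_mult, Hpow.
    rewrite <- (Rmult_1_l (Rabs v)) at 2.
    apply Rmult_le_compat_r; [apply Rabs_pos|].
    rewrite (Rabs_right b) by lra; rewrite <- (pow1 n).
    apply pow_incr; lra. }
  simpl iter; rewrite IH, f_uv by assumption || (
    pose proof (Rle_abs (- ((- U) ^ n * u)));
    pose proof (Rle_abs (- ((- b) ^ n * v))); rewrite Rabs_Ropp in *; lra).
  f_equal; simpl; ring.
Qed.

(** * The unstable manifold and its closure *)

Notation Xs := (fixX (- (U + b)) (U * b)).
Notation W := (Wu f Xs).

Lemma saddle_uv : Xs = uv 0 0.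
Proof.
unfold fixX, uv, X0; f_equal; field; split; nra.
Qed.

Lemma Wu_image P : W P -> W (f P).
Proof.
intros (Q & H0 & HQ & Hc).
exists (fun n => match n with O => f P | S k => Q k end).
split; [reflexivity|]; split.
- intros [|n]; [now rewrite H0 | apply HQ].
- intros e He; destruct (Hc e He) as [N HN]; exists (S N).
  intros [|n] Hn; [lia | apply HN; lia].
Qed.

Lemma Wu_unstable u : Rabs u <= X0 -> W (uv u 0).
Proof.
intros Hu.
assert (Hinv : Rabs (- / U) < 1).
{ rewrite Rabs_Ropp, Rabs_inv, Rabs_right by lra.
  rewrite <- Rinv_1; apply Rinv_lt_contravar; lra. }
exists (fun n => uv ((- / U) ^ n * u) 0); split.
{ simpl; f_equal; ring. }
split.
- intros n; rewrite f_uv.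
  + f_equal; simpl; [field; lra | ring].
  + assert (H : Rabs ((- / U) ^ S n * u) <= X0).
    { rewrite Rabs_mult, <- RPow_abs, <- (Rmult_1_l X0).
      apply Rmult_le_compat; try apply Rabs_pos; try assumption.
      - apply pow_le, Rabs_pos.
      - rewrite <- (pow1 (S n)); apply pow_incr.
        split; [apply Rabs_pos | lra]. }
    pose proof (Rle_abs (- ((- / U) ^ S n * u))) as H'.
    rewrite Rabs_Ropp in H'; lra.
- intros e He; rewrite saddle_uv.
  pose proof X0_pos as HX.
  destruct (pow_lt_1_zero _ Hinv (e / 2 / (2 + U) / X0)) as [N HN].
  { repeat apply Rdiv_lt_0_compat; lra. }
  exists N; intros n Hn.
  replace e with (2 * (e / 2)) by field; apply near_dist2, near_uv.
  + rewrite Rminus_0_r, Rabs_mult.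
    apply Rle_lt_trans with (Rabs ((- / U) ^ n) * X0).
    * apply Rmult_le_compat_l; [apply Rabs_pos | assumption].
    * apply Rlt_le_trans with (e / 2 / (2 + U) / X0 * X0).
      -- apply Rmult_lt_compat_r; auto.
      -- right; field; lra.
  + rewrite Rminus_0_r, Rabs_R0; apply Rdiv_lt_0_compat; lra.
Qed.

(** Far enough back, the orbit stays in a box where the map is linear. There each backward step
    multiplies the stable coordinate by [- 1 / b], so boundedness forces it to vanish. *)
Lemma Wu_local P e : W P -> 0 < e ->
  exists n u, Rabs u < e /\ P = iter f n (uv u 0).
Proof.
intros (Q & H0 & HQ & Hc) He; pose proof X0_pos as HX.
rewrite saddle_uv in Hc.
assert (Hit : forall m n, iter f m (Q (m + n)%nat) = Q n).
{ induction m as [|m IH]; intros n; [reflexivity|].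
  rewrite iter_succ_r; simpl plus; rewrite HQ; apply IH. }
assert (HUb : 0 < (1 + U) / (U - b)) by (apply Rdiv_lt_0_compat; lra).
set (c := (1 + U) / (U - b)) in *.
assert (Hm : 0 < Rmin e (X0 / 2)) by (apply Rmin_glb_lt; lra).
pose proof (Rmin_l e (X0 / 2)); pose proof (Rmin_r e (X0 / 2)).
set (m := Rmin e (X0 / 2)) in *.
destruct (Hc (m / c)) as [N HN]; [apply Rdiv_lt_0_compat; lra|].
assert (Hloc : forall n, (N <= n)%nat ->
          exists u v, Q n = uv u v /\ Rabs u < m /\ Rabs v < m).
{ intros n Hn; specialize (HN n Hn); apply dist2_near in HN.
  destruct (uv_surj (Q n)) as (u & v & E); rewrite E in HN.
  exists u, v; split; [assumption|].
  apply uv_near in HN; fold c in HN.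
  replace (c * (m / c)) with m in HN by (field; lra); exact HN. }
destruct (Hloc N (le_n N)) as (u & v & E & Hu & Hv).
assert (Hback : forall j, exists u' v', Q (j + N)%nat = uv u' v' /\
          Rabs u' < m /\ Rabs v' < m /\ v = (- b) ^ j * v').
{ induction j as [|j (u' & v' & E' & Hu' & Hv' & Ev)].
  - exists u, v; simpl; repeat split; try assumption; ring.
  - destruct (Hloc (S j + N)%nat ltac:(lia)) as (u2 & v2 & E2 & Hu2 & Hv2).
    exists u2, v2; repeat split; try assumption.
    pose proof (HQ (j + N)%nat) as Hf; simpl plus in E2; rewrite E2 in Hf.
    apply Rabs_def2 in Hu2; apply Rabs_def2 in Hv2.
    rewrite f_uv, E' in Hf by lra; unfold uv in Hf; injection Hf as F1 F2.
    assert (Ev' : v' = - b * v2) by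
      (apply Rmult_eq_reg_l with (U - b); nra).
    rewrite Ev, Ev'; simpl; ring. }
assert (Hv0 : v = 0).
{ destruct (Req_dec v 0) as [|Hne]; [assumption|]; exfalso.
  assert (Hpos : 0 < Rabs v) by now apply Rabs_pos_lt.
  destruct (pow_lt_1_zero (- b) ltac:(rewrite Rabs_Ropp, Rabs_right; lra)
              (Rabs v / m)) as [M HM]; [apply Rdiv_lt_0_compat; lra|].
  specialize (HM M (le_n M)).
  destruct (Hback M) as (u' & v' & _ & _ & Hv' & Ev).
  assert (Rabs v < Rabs v / m * m).
  { rewrite Ev at 1; rewrite Rabs_mult.
    apply Rle_lt_trans with (Rabs ((- b) ^ M) * m).
    - apply Rmult_le_compat_l; [apply Rabs_pos | lra].
    - apply Rmult_lt_compat_r; lra. }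
  replace (Rabs v / m * m) with (Rabs v) in * by (field; lra); lra. }
exists N, u; split; [lra|].
rewrite <- H0, <- (Hit N 0%nat), Nat.add_0_r, E, Hv0; reflexivity.
Qed.

Notation Lam := (closure2 W).

Lemma Lam_near P : Lam P <-> forall e, 0 < e -> exists Q, W Q /\ near Q P e.
Proof.
split; intros H e He.
- destruct (H e He) as (Q & HQ & Hd); exists Q; split; [assumption|].
  now apply near_sym, dist2_near.
- destruct (H (e / 2)) as (Q & HQ & Hd); [lra|]; exists Q; split; [assumption|].
  replace e with (2 * (e / 2)) by field; now apply near_dist2, near_sym.
Qed.

Lemma Lam_Wu P : W P -> Lam P.
Proof.
intros H; apply Lam_near; intros e He; exists P; split; [assumption|].
unfold near; rewrite !Rminus_diag, Rabs_R0; lra.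
Qed.

Lemma Lam_image P : Lam P -> Lam (f P).
Proof.
rewrite !Lam_near; intros H e He.
destruct (f_continuous P e He) as (d & Hd & HK).
destruct (H d Hd) as (Q & HQ & HQP); exists (f Q); split; [now apply Wu_image|].
now apply HK.
Qed.

(** * Passages near a point of the closure and returns to the saddle *)

(* Every orbit from a small box around [uv u 0] passes close to [P] at time [N]
   and arrives at time [K] near the local stable manifold of the saddle, after
   which it follows the linear dynamics. *)
Lemma return_chart P e : Lam P -> 0 < e ->
  exists N K u d al be ga de v, (N <= K)%nat /\ 0 < d /\ Rabs u + d <= X0 / 2 /\
    al <> 0 /\
    (forall xi eta, Rabs xi < d -> Rabs eta < d ->
       near (iter f N (uv (u + xi) eta)) P e) /\
    (forall n xi eta, Rabs xi < d -> Rabs eta < d ->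
       Rabs (U ^ n * (al * xi + be * eta)) <= X0 / 2 ->
       iter f (n + K) (uv (u + xi) eta) =
       uv ((- U) ^ n * (al * xi + be * eta))
          ((- b) ^ n * (v + (ga * xi + de * eta)))).
Proof.
intros HP He; pose proof X0_pos as HX.
rewrite Lam_near in HP; destruct (HP (e / 2)) as (P1 & HP1 & HPP1); [lra|].
destruct trap_near_saddle as (r & Hr & HrX & Htr).
destruct (Wu_local P1 r HP1 Hr) as (N & u0 & Hu0 & EP1).
destruct (iter_continuous N (uv u0 0) (e / 2)) as (d1 & Hd1 & HK1); [lra|].
rewrite <- EP1 in HK1.
assert (Hd1' : 0 < d1 / (2 + U) / 2) by (repeat apply Rdiv_lt_0_compat; lra).
destruct (homoclinic_dense r u0 (d1 / (2 + U) / 2) Htr Hu0 Hd1')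
  as (u & k & v & Hu & Hur & Hne & Hk).
destruct (pow_lt_1_zero (- b) ltac:(rewrite Rabs_Ropp, Rabs_right; lra)
            (X0 / 4 / (Rabs v + 1))) as [M HM].
{ pose proof (Rabs_pos v); apply Rdiv_lt_0_compat; lra. }
(* At least [M] to make [v1] small, and at least [N] so that the passage near [P] does not come
   after the arrival. *)
set (j := Nat.max M N); set (v1 := (- b) ^ j * v).
assert (Hv1 : Rabs v1 <= X0 / 4).
{ unfold v1; rewrite Rabs_mult; pose proof (Rabs_pos v).
  apply Rle_trans with (X0 / 4 / (Rabs v + 1) * (Rabs v + 1)).
  - apply Rmult_le_compat; try apply Rabs_pos; [|lra].
    left; apply HM; unfold j; lia.
  - right; field; lra. }
destruct (iter_affine_uv (j + k) u 0 0 v1 (fun i _ => Hne i) (Hk j))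
  as (d2 & al & be & ga & de & Hd2 & Hal & Haff).
set (s := Rabs ga + Rabs de + 1).
assert (Hs : 0 < s)
  by (pose proof (Rabs_pos ga); pose proof (Rabs_pos de); unfold s; lra).
(* In turn: validity of the affine form, closeness to [P], the room [Rabs u + d <= X0 / 2], and a
   change of at most [X0 / 4] in the stable coordinate on arrival. *)
set (d := Rmin (Rmin d2 (d1 / (2 + U) / 2)) (Rmin (X0 / 4) (X0 / 4 / s))).
pose proof (Rmin_l (Rmin d2 (d1 / (2 + U) / 2)) (Rmin (X0 / 4) (X0 / 4 / s))).
pose proof (Rmin_r (Rmin d2 (d1 / (2 + U) / 2)) (Rmin (X0 / 4) (X0 / 4 / s))).
pose proof (Rmin_l d2 (d1 / (2 + U) / 2)).
pose proof (Rmin_r d2 (d1 / (2 + U) / 2)).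
pose proof (Rmin_l (X0 / 4) (X0 / 4 / s)).
pose proof (Rmin_r (X0 / 4) (X0 / 4 / s)).
assert (Hd : 0 < d).
{ assert (0 < X0 / 4 / s) by (repeat apply Rdiv_lt_0_compat; lra).
  unfold d; repeat apply Rmin_glb_lt; lra. }
fold d in H, H0.
exists N, (j + k)%nat, u, d, al, be, ga, de, v1.
split; [unfold j; lia|]; split; [assumption|]; split; [lra|].
split; [assumption|]; split.
- intros xi eta Hxi Heta; replace e with (e / 2 + e / 2) by field.
  apply near_trans with (2 := HPP1), HK1, near_uv.
  + replace (u + xi - u0) with ((u - u0) + xi) by ring.
    apply Rle_lt_trans with (1 := Rabs_triang _ _); lra.
  + rewrite Rminus_0_r; lra.
- intros n xi eta Hxi Heta Hn; rewrite iter_plus.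
  rewrite <- (Rplus_0_l eta) at 1; rewrite Haff by lra; rewrite Rplus_0_l.
  apply linear_phase; [assumption|].
  assert (Hs' : X0 / 4 / s * s = X0 / 4) by (field; lra).
  assert (Rabs (ga * xi + de * eta) <= X0 / 4).
  { apply Rle_trans with (1 := Rabs_triang _ _); rewrite !Rabs_mult.
    pose proof (Rabs_pos ga); pose proof (Rabs_pos de).
    pose proof (Rabs_pos xi); pose proof (Rabs_pos eta).
    assert (Rabs ga * Rabs xi <= Rabs ga * (X0 / 4 / s))
      by (apply Rmult_le_compat_l; lra).
    assert (Rabs de * Rabs eta <= Rabs de * (X0 / 4 / s))
      by (apply Rmult_le_compat_l; lra).
    unfold s in Hs' at 2; lra. }
  apply Rle_trans with (1 := Rabs_triang _ _); lra.
Qed.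

(** * Transitivity and sensitivity *)

Lemma power_separation c B : 0 < c ->
  exists N, forall n, (N <= n)%nat -> b ^ n <= c /\ B <= U ^ n.
Proof.
intros Hc.
destruct (pow_lt_1_zero b ltac:(rewrite Rabs_right; lra) c Hc) as [N1 H1].
destruct (Pow_x_infinity U ltac:(rewrite Rabs_right; lra) B) as [N2 H2].
exists (Nat.max N1 N2); intros n Hn; split.
- left; rewrite <- (Rabs_right (b ^ n)) by (apply Rle_ge, pow_le; lra).
  apply H1; lia.
- apply Rge_le; rewrite <- (Rabs_right (U ^ n)) by (apply Rle_ge, pow_le; lra).
  apply H2; lia.
Qed.

Lemma pow_opp_abs w n : 0 < w -> Rabs ((- w) ^ n) = w ^ n.
Proof. intros H; rewrite <- RPow_abs, Rabs_Ropp, Rabs_right; lra. Qed.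

(** The inclination lemma: [xi] is solved for so that the unstable coordinate lands exactly on [u2],
    while the stable one shrinks like [b ^ m]. Having it for all late [n] lets [Lam_sensitive] reach
    two targets at one time. *)
Lemma Wu_approach P e u2 e' : Lam P -> 0 < e -> Rabs u2 <= X0 / 2 -> 0 < e' ->
  exists M, forall n, (M <= n)%nat ->
    exists Q, W Q /\ near Q P e /\ near (iter f n Q) (uv u2 0) e'.
Proof.
intros HP He Hu2 He'; pose proof X0_pos as HX.
destruct (return_chart P e HP He)
  as (N & K & u & d & al & be & ga & de & v & HNK & Hd & Hud & Hal & HPn & Hret).
set (s := Rabs v + Rabs ga * d + 1).
assert (Hs : 0 < s).
{ pose proof (Rabs_pos v); pose proof (Rabs_pos ga); unfold s.
  assert (0 <= Rabs ga * d) by (apply Rmult_le_pos; lra). lra. }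
assert (Hal' : 0 < Rabs al) by now apply Rabs_pos_lt.
destruct (power_separation (e' / (2 + U) / 2 / s) ((Rabs u2 + 1) / (d * Rabs al)))
  as [M HM]; [repeat apply Rdiv_lt_0_compat; lra|].
exists (M + (K - N))%nat; intros n Hn.
(* From the passage near [P], [K - N] steps lead to the saddle and the other [m] are linear. *)
set (m := (n - (K - N))%nat).
destruct (HM m ltac:(unfold m; lia)) as [Hbm HUm].
assert (HUpos : 0 < U ^ m) by (apply pow_lt; lra).
assert (HUne : (- U) ^ m <> 0) by (apply pow_nonzero; lra).
set (xi := u2 / ((- U) ^ m * al)).
assert (Exi : (- U) ^ m * (al * xi + be * 0) = u2)
  by (unfold xi; field; split; assumption).
assert (Hxi : Rabs xi < d).
{ unfold xi, Rdiv; rewrite Rabs_mult, Rabs_inv, Rabs_mult, pow_opp_abs by lra.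
  apply Rmult_lt_reg_r with (U ^ m * Rabs al); [now apply Rmult_lt_0_compat|].
  rewrite Rmult_assoc, Rinv_l, Rmult_1_r by
    (apply Rgt_not_eq, Rmult_lt_0_compat; assumption).
  assert (Rabs u2 + 1 = (Rabs u2 + 1) / (d * Rabs al) * (d * Rabs al))
    by (field; lra).
  assert ((Rabs u2 + 1) / (d * Rabs al) * (d * Rabs al) <= U ^ m * (d * Rabs al)).
  { apply Rmult_le_compat_r; [|assumption].
    left; now apply Rmult_lt_0_compat. }
  lra. }
exists (iter f N (uv (u + xi) 0)); split; [|split].
- assert (H : W (uv (u + xi) 0)).
  { apply Wu_unstable, Rle_trans with (1 := Rabs_triang _ _); lra. }
  exact (invariant_iter _ W _ _ Wu_image H).
- apply HPn; [assumption | rewrite Rabs_R0; assumption].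
- rewrite <- iter_plus; replace (n + N)%nat with (m + K)%nat by (unfold m; lia).
  rewrite Hret; [|assumption|rewrite Rabs_R0; assumption|].
  + rewrite Exi; apply near_uv.
    * rewrite Rminus_diag, Rabs_R0; apply Rdiv_lt_0_compat; lra.
    * rewrite Rminus_0_r, Rabs_mult, pow_opp_abs by lra.
      assert (Hw : Rabs (v + (ga * xi + de * 0)) <= s).
      { replace (ga * xi + de * 0) with (ga * xi) by ring.
        apply Rle_trans with (1 := Rabs_triang _ _); rewrite Rabs_mult.
        assert (Rabs ga * Rabs xi <= Rabs ga * d)
          by (apply Rmult_le_compat_l; [apply Rabs_pos | lra]).
        unfold s; lra. }
      apply Rle_lt_trans with (e' / (2 + U) / 2 / s * s).
      -- apply Rmult_le_compat; try assumption; [apply pow_le; lra | apply Rabs_pos].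
      -- replace (e' / (2 + U) / 2 / s * s) with (e' / (2 + U) / 2) by (field; lra).
         assert (0 < e' / (2 + U)) by (apply Rdiv_lt_0_compat; lra). lra.
  + replace (Rabs (U ^ m * (al * xi + be * 0)))
      with (Rabs ((- U) ^ m * (al * xi + be * 0))).
    * rewrite Exi; assumption.
    * rewrite !Rabs_mult, pow_opp_abs, (Rabs_right (U ^ m)) by lra; reflexivity.
Qed.

Lemma open2_near (O : pt -> Prop) P : open2 O -> O P ->
  exists e, 0 < e /\ forall Q, near Q P e -> O Q.
Proof.
intros HO HP; destruct (HO P HP) as (e & He & H).
exists (e / 2); split; [lra|]; intros Q HQ; apply H.
replace e with (2 * (e / 2)) by field; now apply near_dist2, near_sym.
Qed.

Lemma Lam_transitive : top_transitive_on f Lam.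
Proof.
intros O1 O2 HO1 HO2 (P1 & HL1 & HP1) (P2 & HL2 & HP2).
destruct (open2_near O1 P1 HO1 HP1) as (e1 & He1 & HN1).
destruct (open2_near O2 P2 HO2 HP2) as (e2 & He2 & HN2).
pose proof X0_pos as HX.
rewrite Lam_near in HL2; destruct (HL2 (e2 / 2)) as (Q2 & HQ2 & Hn2); [lra|].
destruct (Wu_local Q2 (X0 / 2) HQ2) as (m & u2 & Hu2 & EQ2); [lra|].
destruct (iter_continuous m (uv u2 0) (e2 / 2)) as (d & Hd & HK); [lra|].
rewrite <- EQ2 in HK.
destruct (Wu_approach P1 e1 u2 d HL1 He1 ltac:(lra) Hd) as [M HM].
(* [S M] keeps the total time positive even if [m] and [M] vanish. *)
destruct (HM (S M) ltac:(lia)) as (Q & HQ & HQ1 & HQn).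
exists (m + S M)%nat; split; [lia|]; exists Q.
split; [now apply Lam_Wu|]; split; [now apply HN1|].
apply HN2; rewrite iter_plus; replace e2 with (e2 / 2 + e2 / 2) by field.
apply near_trans with (2 := Hn2), HK, HQn.
Qed.

(** Points arbitrarily near [P] come, at one common time, within [X0 / 16] of the targets [u = 0]
    and [u = X0 / 2]. The iterate of [P] cannot be close to both. *)
Lemma Lam_sensitive : sensitive_on f Lam.
Proof.
pose proof X0_pos as HX; exists (X0 / 16); split; [lra|].
intros P HP e He.
destruct (Wu_approach P (e / 2) 0 (X0 / 16) HP) as [M1 H1];
  try (rewrite ?Rabs_R0; lra).
destruct (Wu_approach P (e / 2) (X0 / 2) (X0 / 16) HP) as [M2 H2];
  try (rewrite ?Rabs_right; lra).
set (n := Nat.max M1 M2).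
destruct (H1 n ltac:(lia)) as (Q1 & HQ1 & HP1 & [Hn1 _]).
destruct (H2 n ltac:(lia)) as (Q2 & HQ2 & HP2 & [Hn2 _]).
unfold uv in Hn1, Hn2; simpl in Hn1, Hn2.
apply near_sym, near_dist2 in HP1; apply near_sym, near_dist2 in HP2.
replace (2 * (e / 2)) with e in HP1, HP2 by field.
apply Rabs_def2 in Hn1; apply Rabs_def2 in Hn2.
destruct (Rlt_dec (X0 / 16) (dist2 (iter f n P) (iter f n Q1))) as [H|H].
{ exists Q1; split; [now apply Lam_Wu|]; split; [assumption|]; now exists n. }
exists Q2; split; [now apply Lam_Wu|]; split; [assumption|]; exists n.
apply Rnot_le_lt; intros H'.
destruct (dist2_near (iter f n P) (iter f n Q1) (X0 / 8)) as [F1 _]; [lra|].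
destruct (dist2_near (iter f n P) (iter f n Q2) (X0 / 8)) as [F2 _]; [lra|].
apply Rabs_def2 in F1; apply Rabs_def2 in F2; lra.
Qed.

(** * Density of periodic points *)

(* The return map of a chart in the deviations [xi], [eta] is affine. The root [h]
   makes [xi + h * eta] a left eigenvector of its linear part; on the invariant
   leaf [xi + h * eta = L] the map contracts as [eta |-> c + k * eta]. *)
Lemma return_leaf u v al be ga de d : 0 < d -> al <> 0 ->
  exists n L h c k, (1 <= n)%nat /\ Rabs k <= 1 / 2 /\
    forall eta, Rabs eta <= 2 * Rabs c ->
      Rabs eta < d /\ Rabs (L - h * eta) < d /\
      (- U) ^ n * (al * (L - h * eta) + be * eta) = u + (L - h * (c + k * eta)) /\
      (- b) ^ n * (v + (ga * (L - h * eta) + de * eta)) = c + k * eta.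
Proof.
intros Hd Hal; assert (Ha' : 0 < Rabs al) by now apply Rabs_pos_lt.
pose proof (Rabs_pos be) as Hbe; pose proof (Rabs_pos ga) as Hga.
pose proof (Rabs_pos de) as Hde; pose proof (Rabs_pos u) as Hu.
pose proof (Rabs_pos v) as Hv.
set (H := 2 * (Rabs be / Rabs al) + 1).
assert (HalH : Rabs al * H = 2 * Rabs be + Rabs al) by (unfold H; field; lra).
assert (HH : 0 < H) by nra.
set (G := Rabs ga * H + Rabs de + 1).
assert (HgH : 0 <= Rabs ga * H) by (apply Rmult_le_pos; lra).
assert (HG : 0 < G) by (unfold G; lra).
set (V := Rabs v + Rabs ga * d + 1).
assert (Hgd : 0 <= Rabs ga * d) by (apply Rmult_le_pos; lra).
assert (HV : 0 < V) by (unfold V; lra).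
assert (HVH : 0 < V * (1 + H)) by (apply Rmult_lt_0_compat; lra).
set (Y := Rabs u + H * Rabs v + 1).
assert (HHv : 0 <= H * Rabs v) by (apply Rmult_le_pos; lra).
assert (HY : 0 < Y) by (unfold Y; lra).
(* The three bounds keep [al] dominant in [p] and [D], make the contraction rate at most [1 / 2],
   and make [c] small against [d]. *)
set (c0 := Rmin (Rmin (Rabs al / 4 / G) (1 / 2 / G)) (d / 8 / (V * (1 + H)))).
assert (Hc0 : 0 < c0)
  by (unfold c0; repeat apply Rmin_glb_lt; repeat apply Rdiv_lt_0_compat; lra).
destruct (power_separation c0 (2 / Rabs al * (1 + 2 * Y / d)) Hc0) as [N HN].
destruct (HN (S N) ltac:(lia)) as [HbN HUN]; clear HN.
set (n := S N) in *.
assert (Hb1 : b ^ n * G <= Rabs al / 4).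
{ replace (Rabs al / 4) with (Rabs al / 4 / G * G) by (field; lra).
  apply Rmult_le_compat_r; [lra|]; apply Rle_trans with (1 := HbN).
  apply Rle_trans with (1 := Rmin_l _ _), Rmin_l. }
assert (Hb2 : b ^ n * G <= 1 / 2).
{ replace (1 / 2) with (1 / 2 / G * G) by (field; lra).
  apply Rmult_le_compat_r; [lra|]; apply Rle_trans with (1 := HbN).
  apply Rle_trans with (1 := Rmin_l _ _), Rmin_r. }
assert (Hb3 : b ^ n * V * (1 + H) <= d / 8).
{ replace (d / 8) with (d / 8 / (V * (1 + H)) * (V * (1 + H))) by (field; lra).
  rewrite Rmult_assoc; apply Rmult_le_compat_r; [lra|].
  apply Rle_trans with (1 := HbN), Rmin_r. }
assert (Hbpos : 0 < b ^ n) by (apply pow_lt; lra).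
assert (HU1 : 1 <= U ^ n) by (apply pow_R1_Rle; lra).
assert (HUal : 1 + 2 * Y / d <= U ^ n * (Rabs al / 2)).
{ replace (1 + 2 * Y / d)
    with (2 / Rabs al * (1 + 2 * Y / d) * (Rabs al / 2)) by (field; lra).
  apply Rmult_le_compat_r; lra. }
set (T := (- U) ^ n); set (s := (- b) ^ n).
assert (HT : T <> 0) by (apply pow_nonzero; lra).
assert (HTabs : Rabs T = U ^ n) by (apply pow_opp_abs; lra).
assert (Hsabs : Rabs s = b ^ n) by (apply pow_opp_abs; lra).
set (r := s / T).
assert (Hrs : T * r = s) by (unfold r; field; assumption).
assert (Hr : Rabs r <= b ^ n).
{ assert (Rabs T * Rabs r = b ^ n) by (rewrite <- Rabs_mult, Hrs; assumption).
  apply Rle_trans with (Rabs T * Rabs r); [|lra].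
  rewrite <- (Rmult_1_l (Rabs r)) at 1.
  apply Rmult_le_compat_r; [apply Rabs_pos | lra]. }
assert (HrG : Rabs r * G <= Rabs al / 4)
  by (apply Rle_trans with (2 := Hb1); apply Rmult_le_compat_r; lra).
(* The linear part has rows [T * (al, be)] and [s * (ga, de)]; the left eigenvector equation for
   [(1, h)], divided by [T], is [p h = 0]. As [r] is small, [p] is close to [al * h - be] and
   changes sign on [[- H, H]]. *)
set (p := fun h => r * ga * h * h + (al - r * de) * h - be).
assert (Hend : forall x, Rabs x = H -> Rabs (p x - al * x) < Rabs al * H).
{ intros x Hx; unfold p.
  replace (r * ga * x * x + (al - r * de) * x - be - al * x)
    with (r * (ga * x - de) * x - be) by ring.
  apply Rle_lt_trans with (1 := Rabs_triang _ _).
  rewrite Rabs_Ropp, !Rabs_mult, Hx.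
  assert (Rabs (ga * x - de) <= G).
  { apply Rle_trans with (1 := Rabs_triang _ _).
    rewrite Rabs_Ropp, Rabs_mult, Hx; unfold G; lra. }
  assert (Rabs r * Rabs (ga * x - de) <= Rabs r * G)
    by (apply Rmult_le_compat_l; [apply Rabs_pos | assumption]).
  assert (Rabs r * Rabs (ga * x - de) * H <= Rabs al / 4 * H)
    by (apply Rmult_le_compat_r; lra).
  lra. }
destruct (IVT_cor p (- H) H) as (h & Hh & Hp); [unfold p; reg | lra | |].
{ pose proof (Hend H (Rabs_right H ltac:(lra))) as E1.
  pose proof (Hend (- H) ltac:(rewrite Rabs_Ropp, Rabs_right; lra)) as E2.
  apply Rabs_def2 in E1; apply Rabs_def2 in E2.
  destruct (Rdichotomy _ _ Hal) as [Hs|Hs];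
    [rewrite Rabs_left in E1, E2 by lra | rewrite Rabs_right in E1, E2 by lra].
  - assert (0 < p (- H) * - p H) by (apply Rmult_lt_0_compat; lra). lra.
  - assert (0 < - p (- H) * p H) by (apply Rmult_lt_0_compat; lra). lra. }
assert (Hhabs : Rabs h <= H) by (apply Rabs_le; lra).
assert (Hgh : Rabs (ga * h) <= Rabs ga * H).
{ rewrite Rabs_mult; apply Rmult_le_compat_l; lra. }
(* The eigenvalue of [(1, h)] minus one. Invariance of the leaf at [L] reads
   [L * D = u - s * h * v]. *)
set (D := T * (al + r * (ga * h)) - 1).
assert (HD : 2 * Y / d <= Rabs D).
{ assert (Rabs al * (1 / 2) <= Rabs (al + r * (ga * h))).
  { assert (Rabs (r * (ga * h)) <= Rabs al / 4).
    { rewrite Rabs_mult; apply Rle_trans with (2 := HrG).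
      apply Rmult_le_compat_l; [apply Rabs_pos | unfold G; lra]. }
    pose proof (Rabs_triang_inv al (- (r * (ga * h)))) as Ht.
    rewrite Rabs_Ropp in Ht; unfold Rminus in Ht; rewrite Ropp_involutive in Ht.
    lra. }
  assert (U ^ n * (Rabs al / 2) <= Rabs (T * (al + r * (ga * h)))).
  { rewrite Rabs_mult, HTabs; apply Rmult_le_compat_l; lra. }
  pose proof (Rabs_triang_inv (T * (al + r * (ga * h))) 1) as Ht.
  rewrite Rabs_R1 in Ht; fold D in Ht; lra. }
assert (HYd : 0 < 2 * Y / d) by (apply Rdiv_lt_0_compat; lra).
assert (HD0 : D <> 0) by (intros E; rewrite E, Rabs_R0 in HD; lra).
set (L := (u - s * h * v) / D).
assert (HL : Rabs L < d / 2).
{ assert (HLD : Rabs L * Rabs D <= Y - 1).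
  { rewrite <- Rabs_mult; replace (L * D) with (u - s * h * v)
      by (unfold L; field; assumption).
    apply Rle_trans with (1 := Rabs_triang _ _).
    rewrite Rabs_Ropp, Rmult_assoc, Rabs_mult, Hsabs.
    assert (Rabs (h * v) <= H * Rabs v)
      by (rewrite Rabs_mult; apply Rmult_le_compat_r; lra).
    assert (b ^ n <= 1) by (rewrite <- (pow1 n); apply pow_incr; lra).
    assert (b ^ n * Rabs (h * v) <= 1 * (H * Rabs v))
      by (apply Rmult_le_compat; try apply Rabs_pos; lra).
    unfold Y; lra. }
  assert (Rabs L * (2 * Y / d) <= Rabs L * Rabs D)
    by (apply Rmult_le_compat_l; [apply Rabs_pos | assumption]).
  apply Rmult_lt_reg_r with (2 * Y / d); [assumption|].
  replace (d / 2 * (2 * Y / d)) with Y by (field; lra); lra. }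
set (c := s * (v + ga * L)); set (k := s * (de - ga * h)).
assert (Hc : Rabs c * (1 + H) <= d / 8).
{ apply Rle_trans with (2 := Hb3); apply Rmult_le_compat_r; [lra|].
  unfold c; rewrite Rabs_mult, Hsabs; apply Rmult_le_compat_l; [lra|].
  apply Rle_trans with (1 := Rabs_triang _ _); rewrite Rabs_mult.
  assert (Rabs ga * Rabs L <= Rabs ga * d) by (apply Rmult_le_compat_l; lra).
  unfold V; lra. }
pose proof (Rabs_pos c) as Hcpos.
exists n, L, h, c, k; split; [unfold n; lia|]; split.
{ unfold k; rewrite Rabs_mult, Hsabs; apply Rle_trans with (2 := Hb2).
  apply Rmult_le_compat_l; [lra|].
  apply Rle_trans with (1 := Rabs_triang _ _); rewrite Rabs_Ropp; unfold G; lra. }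
assert (HcH : 0 <= Rabs c * H) by (apply Rmult_le_pos; lra).
intros eta Heta; fold T s; split; [lra|]; split; [|split].
- apply Rle_lt_trans with (1 := Rabs_triang _ _); rewrite Rabs_Ropp, Rabs_mult.
  assert (Rabs h * Rabs eta <= H * (2 * Rabs c))
    by (apply Rmult_le_compat; try apply Rabs_pos; lra).
  lra.
- assert (E1 : T * (be - al * h) = s * h * (ga * h - de)).
  { rewrite <- Hrs; replace be with (r * ga * h * h + (al - r * de) * h - p h)
      by (unfold p; ring).
    rewrite Hp; ring. }
  assert (E2 : L * (T * al + s * (ga * h) - 1) = u - s * h * v).
  { replace (T * al + s * (ga * h) - 1) with D by (unfold D; rewrite <- Hrs; ring).
    unfold L; field; assumption. }
  replace (T * (al * (L - h * eta) + be * eta))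
    with (T * al * L + T * (be - al * h) * eta) by ring.
  rewrite E1; unfold c, k; lra.
- unfold c, k; ring.
Qed.

(** The contraction on the leaf has a fixed point [es], which gives a periodic point. The leaf
    crosses the local unstable manifold at [eta = 0], and the returns of that crossing stay in the
    unstable manifold and converge to the periodic point, which is therefore in the closure. *)
Lemma Lam_periodic_dense : dense_periodic_on f Lam.
Proof.
intros P HP e He; pose proof X0_pos as HX.
destruct (return_chart P (e / 2) HP ltac:(lra))
  as (N & K & u & d & al & be & ga & de & v & HNK & Hd & Hud & Hal & HPn & Hret).
destruct (return_leaf u v al be ga de d Hd Hal)
  as (n & L & h & c & k & Hn & Hk & Hleaf).
set (z := fun eta => uv (u + (L - h * eta)) eta).
pose proof (Rabs_pos c) as Hc.
assert (Hkeep : forall eta, Rabs eta <= 2 * Rabs c ->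
          Rabs (c + k * eta) <= 2 * Rabs c).
{ intros eta Heta; apply Rle_trans with (1 := Rabs_triang _ _).
  rewrite Rabs_mult.
  assert (Rabs k * Rabs eta <= 1 / 2 * (2 * Rabs c))
    by (apply Rmult_le_compat; try apply Rabs_pos; lra).
  lra. }
assert (Hstep : forall eta, Rabs eta <= 2 * Rabs c ->
          iter f (n + K) (z eta) = z (c + k * eta)).
{ intros eta Heta; destruct (Hleaf eta Heta) as (H1 & H2 & H3 & H4).
  destruct (Hleaf _ (Hkeep eta Heta)) as (_ & H5 & _).
  unfold z; rewrite Hret; [now rewrite H3, H4 | assumption | assumption |].
  replace (Rabs (U ^ n * (al * (L - h * eta) + be * eta)))
    with (Rabs ((- U) ^ n * (al * (L - h * eta) + be * eta))).
  - rewrite H3; apply Rle_trans with (1 := Rabs_triang _ _); lra.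
  - rewrite !Rabs_mult, pow_opp_abs, (Rabs_right (U ^ n)); try lra.
    apply Rle_ge, pow_le; lra. }
assert (Hk1 : 1 / 2 <= 1 - k) by (pose proof (Rle_abs k); lra).
set (es := c / (1 - k)).
assert (Ees : c + k * es = es) by (unfold es; field; lra).
assert (Hes : Rabs es <= 2 * Rabs c).
{ unfold es, Rdiv; rewrite Rabs_mult, Rabs_inv, (Rabs_right (1 - k)) by lra.
  apply Rmult_le_reg_r with (1 - k); [lra|].
  rewrite Rmult_assoc, Rinv_l by lra; nra. }
assert (Horb : forall i, exists eta, iter f (i * (n + K)) (z 0) = z eta /\
          Rabs eta <= 2 * Rabs c /\ eta - es = - (k ^ i * es)).
{ induction i as [|i (eta & E & Heta & Ed)].
  - exists 0; split; [reflexivity|]; rewrite Rabs_R0; simpl; split; lra.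
  - exists (c + k * eta); split; [|split; [now apply Hkeep|]].
    + change (S i * (n + K))%nat with (n + K + i * (n + K))%nat.
      rewrite iter_plus, E; now apply Hstep.
    + rewrite <- Ees at 1; simpl.
      replace (c + k * eta - (c + k * es)) with (k * (eta - es)) by ring.
      rewrite Ed; ring. }
assert (Hz0 : W (z 0)).
{ unfold z; apply Wu_unstable.
  destruct (Hleaf 0) as (_ & H & _); [rewrite Rabs_R0; lra|].
  apply Rle_trans with (1 := Rabs_triang _ _); lra. }
assert (Hz : Lam (z es)).
{ apply Lam_near; intros e' He'.
  set (q := (Rabs h + 1) * (Rabs es + 1)).
  pose proof (Rabs_pos h); pose proof (Rabs_pos es).
  assert (Hq : 0 < q) by (apply Rmult_lt_0_compat; lra).
  destruct (pow_lt_1_zero k ltac:(lra) (e' / (2 + U) / q)) as [M HM].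
  { repeat apply Rdiv_lt_0_compat; lra. }
  specialize (HM M (le_n M)).
  destruct (Horb M) as (eta & E & _ & Ed).
  exists (z eta); split; [rewrite <- E; exact (invariant_iter _ W _ _ Wu_image Hz0)|].
  assert (Hkq : Rabs (k ^ M) * q < e' / (2 + U)).
  { replace (e' / (2 + U)) with (e' / (2 + U) / q * q) by (field; lra).
    apply Rmult_lt_compat_r; assumption. }
  assert (Hdiff : (Rabs h + 1) * Rabs (eta - es) < e' / (2 + U)).
  { rewrite Ed, Rabs_Ropp, Rabs_mult; apply Rle_lt_trans with (2 := Hkq).
    unfold q; pose proof (Rabs_pos (k ^ M)).
    assert (Rabs (k ^ M) * ((Rabs h + 1) * Rabs es)
            <= Rabs (k ^ M) * ((Rabs h + 1) * (Rabs es + 1))).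
    { apply Rmult_le_compat_l; [assumption|]; apply Rmult_le_compat_l; lra. }
    lra. }
  pose proof (Rabs_pos (eta - es)).
  assert (0 <= Rabs h * Rabs (eta - es)) by (apply Rmult_le_pos; assumption).
  apply near_uv; [|lra].
  replace (u + (L - h * eta) - (u + (L - h * es))) with (- (h * (eta - es))) by ring.
  rewrite Rabs_Ropp, Rabs_mult; lra. }
assert (Hfix : iter f (n + K) (z es) = z es) by (rewrite Hstep, Ees; auto).
exists (iter f N (z es)); split; [|split].
- exact (invariant_iter _ Lam _ _ Lam_image Hz).
- destruct (Hleaf es Hes) as (H1 & H2 & _).
  replace e with (2 * (e / 2)) by field.
  apply near_dist2, near_sym, HPn; assumption.
- exists (n + K)%nat; split; [lia|].
  rewrite <- iter_plus, Nat.add_comm, iter_plus, Hfix; reflexivity.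
Qed.

Lemma nform_chaotic : devaney_chaotic_on f Lam.
Proof.
split; [exact Lam_transitive | split; [exact Lam_periodic_dense | exact Lam_sensitive]].
Qed.

End NormalForm.

(** * Passage from the parameters to the eigenvalues *)

Theorem theorem2p2 (tL dL tR dR : R) :
  in_Phi tL dL tR dR ->
  phi_BYG tL dL tR dR > 0 ->
  J1 tL dL tR dR > 1 ->
  J2 tL dL tR dR < 1 ->
  devaney_chaotic_on (f_xi tL dL tR dR)
    (closure2 (Wu (f_xi tL dL tR dR) (fixX tR dR))).
Proof.
unfold in_Phi, phi_BYG, J1, J2; intros (HtL & HdL & HtR & HdR) Hphi HJ1 HJ2.
assert (HsL : 0 <= tL ^ 2 - 4 * dL).
{ assert ((dL + 1) ^ 2 <= tL ^ 2) by (apply pow_incr; lra).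
  pose proof (pow2_ge_0 (dL - 1)); lra. }
assert (HsR : 0 <= tR ^ 2 - 4 * dR).
{ assert ((dR + 1) ^ 2 <= (- tR) ^ 2) by (apply pow_incr; lra).
  pose proof (pow2_ge_0 (dR - 1)); lra. }
set (l := lamLu tL dL) in *; set (a := lamLs tL dL) in *.
set (U := - lamRu tR dR); set (b := - lamRs tR dR).
assert (EL : l + a = tL) by (unfold l, a, lamLu, lamLs; field).
assert (ER : - (U + b) = tR) by (unfold U, b, lamRu, lamRs; field).
assert (PL : l * a = dL).
{ unfold l, a, lamLu, lamLs.
  pose proof (sqrt_sqrt _ HsL); lra. }
assert (PR : U * b = dR).
{ unfold U, b, lamRu, lamRs.
  pose proof (sqrt_sqrt _ HsR); lra. }
assert (OL : a <= l).
{ unfold l, a, lamLu, lamLs; pose proof (sqrt_pos (tL ^ 2 - 4 * dL)); lra. }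
assert (OR : b <= U).
{ unfold U, b, lamRu, lamRs; pose proof (sqrt_pos (tR ^ 2 - 4 * dR)); lra. }
(* The last premise says [0 < (y - 1) * (1 - x)], so the two eigenvalue moduli lie on either side of
   1. *)
assert (Hpos : forall x y, x <= y -> 0 < y * x -> y * x + 1 < y + x ->
          0 < x /\ 1 < y).
{ intros x y Hxy Hprod Hsum; split; [nra|]; apply Rnot_le_lt; intros Hy; nra. }
destruct (Hpos a l OL) as [Ha Hl]; [lra | lra |].
destruct (Hpos b U OR) as [Hb HU]; [lra | lra |].
assert (Hab : a + b < 1).
{ apply Rle_lt_trans with (2 := HJ2); apply Rplus_le_compat.
  - apply Rmax_l.
  - apply Rle_trans with (2 := Rmax_l _ _).
    unfold b; rewrite <- Rabs_Ropp; apply Rle_abs. }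
assert (HJ : l + U < l * U ^ 2).
{ replace (lamRu tR dR) with (- U) in HJ1 by (unfold U; ring).
  rewrite Rabs_Ropp, Rabs_right in HJ1 by lra.
  replace (l * U ^ 2) with (l * (- U) ^ 2 / (l + U) * (l + U)) by (field; lra).
  nra. }
rewrite <- EL, <- ER, <- PL, <- PR in *.
apply nform_chaotic; assumption || lra.
Qed.
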